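(* Assume that the scheme is Cauchy-stable, i.e. $\left|\sum_{k=-r}^{p} a_k e^{ik\xi}\right|\leq 1$ for all $\xi\in\mathbb{R}$. Then the intrinsic Kreiss-Lopatinskii determinant $$\Delta(z)=\frac{\det\left(zK_{0,r-1}(z)-\mathcal{B}K_{0,m-1}(z)\right)}{\det K_{0,r-1}(z)}$$ is holomorphic on $\mathcal{U}=\{z\in\mathbb{C}: |z|>1\}$ and continuous on $\overline{\mathcal{U}}=\{z\in\mathbb{C}:|z|\geq 1\}$.
   Context: Notation: $\mathbb{S}=\{|z|=1\}$, $\mathbb{D}=\{|z|<1\}$, $\mathcal{U}=\{|z|>1\}$, $\overline{\mathcal{U}}=\{|z|\geq 1\}$ in $\mathbb{C}$. Scheme: let $r,p\geq 1$ be integers, $a_{-r},\dots,a_p$ complex coefficients with $a_{-r}\neq 0$ and $a_p\neq 0$, $m\geq p+r$ an integer, and $(b_{j,k})_{-r\leq j\leq -1,\ 0\leq k\leq m-1}$ complex coefficients. The scheme is $$U_j^{n+1}=\sum_{k=-r}^{p}a_kU_{j+k}^n\ (j\geq 0,\,n\geq0),\qquad U_j^n=\sum_{k=0}^{m-1}b_{j,k}U_k^n+g_j^n\ (-r\leq j\leq -1,\,n\geq 0),\qquad U_j^0=f_j\ (j\geq 0).$$ The boundary matrix $\mathcal{B}\in\mathcal{M}_{r,m}(\mathbb{C})$ (rows indexed by $i=0,\dots,r-1$, columns by $k=0,\dots,m-1$) obtained by eliminating the ghost values $U_j^n$, $-r\leq j\leq -1$, from the first $r$ interior equations is $$\mathcal{B}_{i,k}=a_{k-i}+\sum_{l=-r}^{-1}a_{l-i}\,b_{l,k},\qquad\text{with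 the convention } a_q=0 \text{ if } q\notin\{-r,\dots,p\}.$$ Roots: the characteristic equation, with unknown $\kappa$ and parameter $z$, is $z\kappa^r=\sum_{k=-r}^{p}a_k\kappa^{r+k}$. Under Cauchy-stability, for $z\in\mathcal{U}$ it has exactly $r$ roots in $\mathbb{D}$ and $p$ roots in $\mathcal{U}$, counted with multiplicity, and none on $\mathbb{S}$. For $z\in\mathcal{U}$, let $\kappa_1(z),\dots,\kappa_M(z)$ be the distinct roots in $\mathbb{D}$, with multiplicities $\beta_1,\dots,\beta_M$, $\beta_1+\dots+\beta_M=r$. For $z\in\mathbb{S}$, the same notation denotes the $r$ roots (in $\overline{\mathbb{D}}$) ''coming from the inside'', i.e. the limit, as $z'\to z$ with $z'\in\mathcal{U}$, of the multiset of the $r$ roots in $\mathbb{D}$ for $z'$; $\kappa_1(z),\dots,\kappa_M(z)$ are its distinct elements and $\beta_1,\dots,\beta_M$ their multiplicities in this limit multiset. Matrices: for $0\leq i<j$ (and $i=j$ when $r=1$), $K_{i,j}(z)\in\mathcal{M}_{j-i+1,r}(\mathbb{C})$ is the matrix whose $r$ columns are the rows of index $i$ to $j$ (included, indices starting at $0$) of the $r$ sequences $(q^{s}\kappa_\ell(z)^q)_{q\geq 0}$, $\ell=1,\dots,M$, $s=0,\dots,\beta_\ell-1$ (convention $0^0=1$). The order of the columns is arbitrary but the same for all $K_{i,j}(z)$ at a given $z$; $\Delta(z)$ does not depend on it. *)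

(* Defs.v *)
From HB Require Import structures.
From mathcomp Require Import all_boot all_order all_algebra.
From mathcomp Require Import complex.
From mathcomp Require Import all_classical all_reals all_analysis.

Set Implicit Arguments.
Unset Strict Implicit.
Unset Printing Implicit Defensive.
Import Order.TTheory GRing.Theory Num.Theory.
Import numFieldNormedType.Exports.

Local Open Scope classical_set_scope.
Local Open Scope ring_scope.

(* The complex numbers, packed as a [numClosedFieldType] so that they inherit
   the metric topology and normed-module structure that MathComp-Analysis puts
   on every [numFieldType].  The scalar field of this normed module is the
   complex field itself, so [derivable f z 1] is complex differentiability. *)
Definition Cplx (R : realType) : numClosedFieldType := complex R.

Definition expi (R : realType) (t : R) : Cplx R := Complex (cos t) (sin t).

Section Scheme.
Variables (R : realType) (r p : nat).
Local Notation C := (Cplx R).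

(* Signed index of the [k]-th term of a sum starting at [- r]. *)
Definition sidx (k : nat) : int := k%:Z - r%:Z.

(* Only the values of [a] on [- r, p] matter: every other occurrence of a
   coefficient goes through [coef_ext]. *)
Variable a : int -> C.

Definition coef_ext (q : int) : C :=
  if (- r%:Z <= q) && (q <= p%:Z) then a q else 0.

Definition cauchy_stable : Prop :=
  forall xi : R,
    `| \sum_(k < (r + p).+1) a (sidx k) * expi ((sidx k)%:~R * xi) | <= 1.

Section BoundaryMatrix.
Variables (m : nat) (b : int -> 'I_m -> C).

(* The ghost index ranges over [- r, - 1], i.e. over [sidx l] for [l < r]. *)
Definition boundary_mx : 'M[C]_(r, m) :=
  \matrix_(i < r, k < m)
    (coef_ext (k%:Z - i%:Z)
     + \sum_(l < r) coef_ext (sidx l - i%:Z) * b (sidx l) k).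

End BoundaryMatrix.

(* z kappa^r - \sum_(- r <= k <= p) a_k kappa^(r + k), in the unknown kappa *)
Definition scheme_poly (z : C) : {poly C} :=
  z *: 'X^r - \sum_(k < (r + p).+1) a (sidx k) *: 'X^k.

(* Multisets of roots are represented by sequences, up to [perm_eq]. *)
Definition roots_mult (P : {poly C}) : seq C :=
  sval (closed_field_poly_normal P).

Definition roots_in_disc (z : C) : seq C :=
  [seq x <- roots_mult (scheme_poly z) | `|x| < 1].

(* The multiset [s] is the limit of [roots_in_disc z'] as z' -> z, |z'| > 1:
   the elements can be paired at arbitrarily small distance. *)
Definition roots_from_inside (z : C) (s : seq C) : Prop :=
  forall e : C, 0 < e ->
    \forall z' \near within [set w : C | 1 < `|w|] (nbhs z),
      exists2 t : seq C, perm_eq t (roots_in_disc z')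
                       & all2 (fun x y => `|x - y| < e) t s.

(* Meaningful for [1 <= `|z|] only; the second branch is meant for
   [`|z| = 1]. *)
Definition kappas (z : C) : seq C :=
  if 1 < `|z| then roots_in_disc z
  else xget [::] [set s | roots_from_inside z s].

(* The pairs (kappa_l, s), 0 <= s < beta_l, over the distinct kappa_l. *)
Definition modes (z : C) : seq (C * nat) :=
  [seq (x, s) | x <- undup (kappas z), s <- iota 0 (count_mem x (kappas z))].

(* The matrix K_{0,n-1}(z): rows q = 0, ..., n - 1 of the sequences
   q^s kappa^q. *)
Definition Kmx (n : nat) (z : C) : 'M[C]_(n, r) :=
  \matrix_(q < n, c < r)
    (let ks := nth (0, 0%N) (modes z) c in
     (q%:R : C) ^+ ks.2 * ks.1 ^+ q).

Definition KL_det (m : nat) (b : int -> 'I_m -> C) (z : C) : C :=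
  \det (z *: Kmx r z - boundary_mx b *m Kmx m z) / \det (Kmx r z).

End Scheme.

(* Main.v *)
Require Import Defs.
From HB Require Import structures.
From mathcomp Require Import all_boot all_order all_algebra.
From mathcomp Require Import ring lra.
From mathcomp Require Import complex.
From mathcomp Require Import all_classical all_reals all_analysis.

Import Order.TTheory GRing.Theory Num.Theory.
Import numFieldNormedType.Exports.
Local Open Scope classical_set_scope.
Local Open Scope ring_scope.

Set Implicit Arguments.
Unset Strict Implicit.
Unset Printing Implicit Defensive.

(** The determinant sees the roots only through the monic polynomial
    S_z(X) = prod (X - kappa), the product being over the r roots coming from
    the inside.  Each sequence q^s kappa^q with s below the multiplicity of
    kappa satisfies the linear recurrence whose characteristic polynomial is
    S_z, so row q of K_{0,m-1}(z) is the combination of the rows of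
    K_{0,r-1}(z) given by the coefficients of X^q mod S_z ([mode_mx_reduce]).
    As a_{-r} <> 0, no kappa vanishes and the confluent Vandermonde matrix
    K_{0,r-1}(z) is invertible ([mode_mx_unit]); it cancels from the quotient,
    which leaves
      Delta(z) = det (z I - B C(z)),  C(z)_{q,j} = coefficient j of X^q mod S_z
    ([mode_det_reduce]).  This is a polynomial in z and in the coefficients of
    S_z, so it remains to study these coefficients as functions of z.

    Continuity.  The roots of a polynomial of fixed degree, as a multiset,
    depend continuously on its coefficients ([coef_cvg_ms]).  Cauchy-stability
    keeps the roots off the unit circle when |z| > 1; hence the roots in the
    disc vary continuously with z, and a homotopy to a binomial shows that
    there are r of them ([size_roots_in_disc]).  When |z| = 1, some roots of
    the characteristic polynomial P_z may lie on the circle and be approached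
    from either side.  Still, the roots in the disc for w near z, |w| > 1, are
    close to a sub-multiset of the roots of P_z; there are finitely many of
    these, and the half-neighbourhood of z outside the disc is connected, so it
    is always the same one: the limit multiset exists
    ([exists_roots_from_inside]).  A function on the closed exterior which, at
    every point, is the limit of its values from the open exterior is
    continuous ([cvg_within_closure]).

    Holomorphy.  Write P_z = S_z T.  As P_w = P_z + (w - z) X^r is a multiple
    of S_w,
      (S_w - S_z) T = (w - z) X^r  modulo S_w,
    so the difference quotient of S solves a linear system, with matrix the
    multiplication by T modulo S_w.  At w = z this matrix is invertible, as T
    and S_z are coprime; Cramer's formulas and the continuity of S then give the
    limit of the difference quotient ([derivable_factor_coef]). *)

(** * Confluent Vandermonde matrices and linear recurrences *)

(** The operator X d/dX: the sequence q^s x^q, paired with the coefficients of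
    a polynomial p, gives the value at x of theta^s p.  Columns of K become
    linear forms on polynomials in this way. *)
Definition theta (K : fieldType) (p : {poly K}) : {poly K} := 'X * p^`().

Lemma coef_iter_theta (K : fieldType) (s : nat) (p : {poly K}) (q : nat) :
  (iter s (@theta K) p)`_q = q%:R ^+ s * p`_q.
Proof.
elim: s => [|s IHs] /=; first by rewrite expr0 mul1r.
rewrite /theta coefXM coef_deriv exprS -mulrA -IHs.
by case: q {IHs} => [|q] /=; rewrite ?mul0r // mulr_natl.
Qed.

Lemma horner_iter_theta (K : fieldType) (s n : nat) (p : {poly K}) (x : K) :
  (size p <= n)%N ->
  (iter s (@theta K) p).[x] = \sum_(q < n) p`_q * (q%:R ^+ s * x ^+ q).
Proof.
move=> pn; rewrite (horner_coef_wide (n := n)).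
  by apply: eq_bigr => q _; rewrite coef_iter_theta mulrCA mulrA.
apply/leq_sizeP => j nj; rewrite coef_iter_theta nth_default ?mulr0 //.
exact: leq_trans nj.
Qed.

Lemma horner_iter_thetaD (K : fieldType) (s : nat) (p q : {poly K}) (x : K) :
  (iter s (@theta K) (p + q)).[x]
  = (iter s (@theta K) p).[x] + (iter s (@theta K) q).[x].
Proof.
rewrite -hornerD; congr (_.[_]); apply/polyP => j.
by rewrite coefD !coef_iter_theta coefD mulrDr.
Qed.

Lemma theta_mul_XsubC (K : fieldType) (k : nat) (g : {poly K}) (x : K) :
  theta (g * ('X - x%:P) ^+ k.+1)
  = ('X * (g^`() * ('X - x%:P)) + k.+1%:R *: ('X * g)) * ('X - x%:P) ^+ k.
Proof.
rewrite /theta derivM deriv_exp derivXsubC mul1r /= exprSr -mulr_natl -polyC_natr.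
by rewrite -mul_polyC; ring.
Qed.

(** Only the terms in which every derivative hits a factor X - x survive at x.
    This is the triangularity behind the invertibility of the confluent
    Vandermonde matrix. *)
Lemma horner_iter_theta_XsubC (K : fieldType) (k : nat) (g : {poly K}) (x : K) :
  (iter k (@theta K) (g * ('X - x%:P) ^+ k)).[x] = k`!%:R * x ^+ k * g.[x].
Proof.
elim: k g => [|k IHk] g /=; first by rewrite !expr0 !mulr1 mul1r.
rewrite -iterS iterSr theta_mul_XsubC IHk.
rewrite !(hornerXsubC, hornerD, hornerM, hornerZ, hornerX) factS natrM exprS.
by ring.
Qed.

(** Each application of theta costs at most one factor X - x. *)
Lemma root_iter_theta (K : fieldType) (s k : nat) (p : {poly K}) (x : K) :
  (s < k)%N -> ('X - x%:P) ^+ k %| p -> root (iter s (@theta K) p) x.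
Proof.
elim: s k p => [|s IHs] [|k] p //= sk.
  by move/dvdpP => [g ->]; rewrite exprSr mulrA rootM root_XsubC eqxx orbT.
rewrite -iterS iterSr => /dvdpP [g ->]; apply: (IHs k) => //.
by rewrite theta_mul_XsubC dvdp_mull.
Qed.

(** Converse of [root_iter_theta].  It needs x <> 0, since theta vanishes at 0
    identically, and characteristic 0, for k! to be invertible. *)
Lemma dvdp_XsubC_theta (K : fieldType) (k : nat) (p : {poly K}) (x : K) :
  [pchar K] =i pred0 -> x != 0 ->
  (forall s, (s < k)%N -> root (iter s (@theta K) p) x) ->
  ('X - x%:P) ^+ k %| p.
Proof.
move=> char0 x0; elim: k => [|k IHk] rootp; first by rewrite expr0 dvd1p.
have /dvdpP [g pE] := IHk (fun s sk => rootp s (leqW sk)).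
have := rootp k (leqnn _); rewrite /root pE horner_iter_theta_XsubC.
rewrite !mulf_eq0 ((pcharf0P K).1 char0) (negPf (expf_neq0 _ x0)).
rewrite -leqn0 leqNgt fact_gt0 /=.
by rewrite -/(root g x) -dvdp_XsubCl exprS => gx; apply: dvdp_mul.
Qed.

Lemma dvdp_prod_XsubC_count (K : fieldType) (ks : seq K) (p : {poly K}) :
  (forall x, x \in ks -> ('X - x%:P) ^+ count_mem x ks %| p) ->
  \prod_(x <- ks) ('X - x%:P) %| p.
Proof.
have [-> _|p0] := eqVneq p 0; first exact: dvdp0.
elim: ks p p0 => [|y ks IHks] p p0 dvd; first by rewrite big_nil dvd1p.
have /dvdpP [q pE] : 'X - y%:P %| p.
  apply: dvdp_trans (dvd y (mem_head _ _)).
  by rewrite /= eqxx exprS dvdp_mulr.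
have q0 : q != 0 by apply: contraNneq p0 => q0; rewrite pE q0 mul0r.
rewrite big_cons pE mulrC dvdp_mul2r ?polyXsubC_eq0 //; apply: IHks => // x xks.
have := dvd x; rewrite in_cons xks orbT -!mup_geq // pE mulrC.
rewrite mupM // ?polyXsubC_eq0 // (@mup_XsubCX _ 1) /= => /(_ isT).
by rewrite eq_sym leq_add2l.
Qed.

Lemma dvdp_XsubCX_count (K : fieldType) (ks : seq K) (x : K) :
  ('X - x%:P) ^+ count_mem x ks %| \prod_(y <- ks) ('X - y%:P).
Proof.
by rewrite -mup_geq ?mu_prod_XsubC // monic_neq0 // monic_prod_XsubC.
Qed.

Definition mode_seq (K : eqType) (ks : seq K) : seq (K * nat) :=
  [seq (x, s) | x <- undup ks, s <- iota 0 (count_mem x ks)].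

Lemma size_mode_seq (K : eqType) (ks : seq K) : size (mode_seq ks) = size ks.
Proof.
rewrite size_allpairs_dep -(perm_size (perm_count_undup ks)) size_flatten.
rewrite /shape -map_comp; congr (sumn _); apply: eq_map => x /=.
by rewrite size_iota size_nseq.
Qed.

Lemma mem_mode_seq (K : eqType) (ks : seq K) (x : K) (s : nat) :
  ((x, s) \in mode_seq ks) = (s < count_mem x ks)%N.
Proof.
apply/allpairsPdep/idP => [[y [t [_]]]|sx].
  by rewrite mem_iota => /andP [_ ty] [-> ->].
exists x, s; split => //; last by rewrite mem_iota.
by rewrite mem_undup -has_pred1 has_count (leq_ltn_trans _ sx).
Qed.

(** The matrix K_{0,n-1} of an arbitrary multiset of roots. *)
Definition mode_mx (K : fieldType) (r n : nat) (ks : seq K) : 'M[K]_(n, r) :=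
  \matrix_(q < n, c < r)
    (let k := nth (0, 0%N) (mode_seq ks) c in (q%:R : K) ^+ k.2 * k.1 ^+ q).

Section Reduction.
Variables (K : fieldType) (ks : seq K) (r : nat).
Hypothesis ks_size : size ks = r.
Let S := \prod_(x <- ks) ('X - x%:P).

Lemma mode_mxE (n : nat) (c : 'I_r) (p : {poly K}) : (size p <= n)%N ->
  let k := nth (0, 0%N) (mode_seq ks) c in
  \sum_(q < n) p`_q * mode_mx r n ks q c = (iter k.2 (@theta K) p).[k.1].
Proof.
move=> pn k; rewrite (horner_iter_theta _ _ pn).
by apply: eq_bigr => q _; rewrite mxE.
Qed.

Lemma count_mode (c : 'I_r) (k := nth (0, 0%N) (mode_seq ks) c) :
  (k.2 < count_mem k.1 ks)%N.
Proof.
rewrite -mem_mode_seq -surjective_pairing.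
by rewrite mem_nth // size_mode_seq ks_size.
Qed.

(** The linear form given by a column vanishes on the multiples of S, hence
    takes the same value on X^q and on its remainder modulo S. *)
Lemma mode_mx_reduce (n : nat) :
  mode_mx r n ks
  = (\matrix_(q < n, j < r) ('X^q %% S)`_j) *m mode_mx r r ks.
Proof.
have Ssize : size S = r.+1 by rewrite size_prod_XsubC ks_size.
apply/matrixP => q c; rewrite !mxE.
under eq_bigr do rewrite mxE.
rewrite mode_mxE; last by rewrite -ltnS -Ssize ltn_modp -size_poly_gt0 Ssize.
set k := nth _ _ c.
have -> : (iter k.2 (@theta K) ('X^q %% S)).[k.1]
        = (iter k.2 (@theta K) 'X^q).[k.1].
  rewrite [in RHS](divp_eq 'X^q S) horner_iter_thetaD.
  have Sk : ('X - k.1%:P) ^+ count_mem k.1 ks %| 'X^q %/ S * S.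
    by apply: dvdp_mull; exact: dvdp_XsubCX_count.
  by rewrite (rootP (root_iter_theta (count_mode c) Sk)) add0r.
rewrite (@horner_iter_theta _ k.2 q.+1) ?size_polyXn //.
rewrite big_ord_recr /= coefXn eqxx mul1r big1 ?add0r // => i _.
by rewrite coefXn (ltn_eqF (ltn_ord i)) mul0r.
Qed.

(** A linear relation between the rows is a polynomial of degree less than r
    killed by all the forms theta^s at kappa, hence divisible by S
    ([dvdp_XsubC_theta]). *)
Lemma mode_mx_unit : [pchar K] =i pred0 -> 0 \notin ks ->
  mode_mx r r ks \in unitmx.
Proof.
move=> char0 ks0; rewrite -row_free_unit -kermx_eq0; apply/rowV0P => v.
move/sub_kermxP => vK0.
suff p0 : rVpoly v = 0 by rewrite -[v]rVpolyK p0 linear0.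
have Ssize : size S = r.+1 by rewrite size_prod_XsubC ks_size.
have pr : (size (rVpoly v) <= r)%N by exact: size_poly.
suff /eqP : rVpoly v %% S = 0 by move=> /eqP; rewrite modp_small // Ssize ltnS.
apply/eqP; rewrite -[_ == 0]/(S %| rVpoly v).
apply: dvdp_prod_XsubC_count => x xks.
apply: dvdp_XsubC_theta => // [|s sx]; first by apply: contraNneq ks0 => <-.
have xs_in : (x, s) \in mode_seq ks by rewrite mem_mode_seq.
have cr : (index (x, s) (mode_seq ks) < r)%N.
  by rewrite -ks_size -size_mode_seq index_mem.
have := mode_mxE (Ordinal cr) pr; rewrite /= nth_index //= /root => <-.
move/rowP: vK0 => /(_ (Ordinal cr)); rewrite !mxE => vK0.
by rewrite -[X in _ == X]vK0; apply/eqP/eq_bigr => i _; rewrite coef_rVpoly_ord.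
Qed.

End Reduction.

(** * The reduced determinant, a polynomial in the coefficients of the factor *)

(** The coefficients of X^q mod S for S monic of degree r ([XremE]), in a form
    that is visibly polynomial in the coefficients s of S. *)
Fixpoint Xrem (K : nzRingType) (r : nat) (s : nat -> K) (q j : nat) : K :=
  if q is q'.+1 then
    (if j is j'.+1 then Xrem r s q' j' else 0) - Xrem r s q' r.-1 * s j
  else (j == 0%N)%:R.

Lemma XremE (K : fieldType) (S : {poly K}) (r q j : nat) :
  S \is monic -> size S = r.+1 -> (0 < r)%N ->
  Xrem r (fun i => S`_i) q j = ('X^q %% S)`_j.
Proof.
move=> Smonic Ssize r0; elim: q j => [|q IHq] j /=.
  by rewrite expr0 modp_small ?coef1 // size_poly1 Ssize ltnS.
pose A : {poly K} := 'X^q %% S; have Asize : (size A <= r)%N.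
  by rewrite -ltnS -Ssize ltn_modp monic_neq0.
have Sr : S`_r = 1 by move/monicP: Smonic; rewrite lead_coefE Ssize.
have <- : 'X * A - A`_r.-1 *: S = 'X^(q.+1) %% S.
  apply: (@modpP _ _ ('X * ('X^q %/ S) + (A`_r.-1)%:P)).
    by rewrite exprS {1}(divp_eq 'X^q S) -mul_polyC -/A; ring.
  rewrite Ssize ltnS; apply/leq_sizeP => i.
  rewrite leq_eqVlt coefB coefXM coefZ => /predU1P [<-|ri].
    by rewrite Sr mulr1 (gtn_eqF r0) subrr.
  rewrite [S`_i]nth_default ?Ssize // mulr0 subr0.
  case: i ri => // i ri; rewrite nth_default //.
  exact: leq_trans Asize _.
rewrite coefB coefXM coefZ IHq -/A; congr (_ - _).
by case: j.
Qed.

Definition reduced_det (K : fieldType) (r m : nat) (B : 'M[K]_(r, m))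
    (z : K) (s : nat -> K) : K :=
  \det (z%:M - B *m \matrix_(q < m, j < r) Xrem r s q j).

(** The factor K_{0,r-1} comes out of the numerator on the right, by
    [mode_mx_reduce], and cancels. *)
Lemma mode_det_reduce (K : fieldType) (r m : nat) (B : 'M[K]_(r, m)) (z : K)
    (ks : seq K) :
  [pchar K] =i pred0 -> size ks = r -> (0 < r)%N -> 0 \notin ks ->
  \det (z *: mode_mx r r ks - B *m mode_mx r m ks) / \det (mode_mx r r ks)
  = reduced_det B z (fun j => (\prod_(x <- ks) ('X - x%:P))`_j).
Proof.
move=> char0 ksr r0 ks0; rewrite [mode_mx r m ks](mode_mx_reduce ksr).
rewrite -mul_scalar_mx mulmxA -mulmxBl det_mulmx mulfK; last first.
  by rewrite -unitfE -unitmxE mode_mx_unit.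
congr (\det (_ - _ *m _)); apply/matrixP => q j; rewrite !mxE XremE //.
  exact: monic_prod_XsubC.
by rewrite size_prod_XsubC ksr.
Qed.

(** Continuity and differentiability are both stable under sums and products;
    the reduced determinant inherits any such property from z and from the
    coefficients of S.  Working with an abstract class Q of functions treats the
    two at once. *)
Section FunctionAlgebra.
Variables (T : Type) (K : fieldType) (Q : (T -> K) -> Prop).
Hypothesis Q_cst : forall c, Q (fun=> c).
Hypothesis Q_add : forall f g, Q f -> Q g -> Q (fun w => f w + g w).
Hypothesis Q_mul : forall f g, Q f -> Q g -> Q (fun w => f w * g w).

Lemma funalg_opp f : Q f -> Q (fun w => - f w).
Proof.
move=> Qf; rewrite (_ : (fun w => _) = (fun w => -1 * f w)).
  exact: (Q_mul (f := fun=> -1)).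
by apply/funext => w; rewrite mulN1r.
Qed.

Lemma funalg_sum (I : Type) (s : seq I) (F : I -> T -> K) :
  (forall i, Q (F i)) -> Q (fun w => \sum_(i <- s) F i w).
Proof.
move=> QF; elim: s => [|i s IHs].
  by rewrite (_ : (fun w => _) = fun=> 0) //; apply/funext => w; rewrite big_nil.
rewrite (_ : (fun w => _) = (fun w => F i w + \sum_(j <- s) F j w)).
  exact: Q_add.
by apply/funext => w; rewrite big_cons.
Qed.

Lemma funalg_prod (I : Type) (s : seq I) (F : I -> T -> K) :
  (forall i, Q (F i)) -> Q (fun w => \prod_(i <- s) F i w).
Proof.
move=> QF; elim: s => [|i s IHs].
  by rewrite (_ : (fun w => _) = fun=> 1) //; apply/funext => w; rewrite big_nil.
rewrite (_ : (fun w => _) = (fun w => F i w * \prod_(j <- s) F j w)).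
  exact: Q_mul.
by apply/funext => w; rewrite big_cons.
Qed.

Lemma funalg_det (n : nat) (A : T -> 'M[K]_n) :
  (forall i j, Q (fun w => A w i j)) -> Q (fun w => \det (A w)).
Proof.
move=> QA; apply: funalg_sum => s; apply: Q_mul; first exact: Q_cst.
exact: funalg_prod.
Qed.

Lemma funalg_Xrem (r q j : nat) (s : T -> nat -> K) :
  (forall i, Q (fun w => s w i)) -> Q (fun w => Xrem r (s w) q j).
Proof.
move=> Qs; elim: q j => [|q IHq] j /=; first exact: Q_cst.
apply: Q_add; first by case: j => [|j]; [exact: Q_cst|exact: IHq].
by apply: funalg_opp; apply: Q_mul.
Qed.

Lemma funalg_reduced_det (r m : nat) (B : 'M[K]_(r, m)) (z : T -> K)
    (s : T -> nat -> K) :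
  Q z -> (forall i, Q (fun w => s w i)) ->
  Q (fun w => reduced_det B (z w) (s w)).
Proof.
move=> Qz Qs; apply: funalg_det => i j.
rewrite (_ : (fun w => _) = fun w =>
  (z w * (i == j)%:R) + - \sum_(q < m) B i q * Xrem r (s w) q j).
  apply: Q_add; first by apply: Q_mul => //; exact: Q_cst.
  apply: funalg_opp; apply: funalg_sum => q; apply: Q_mul; first exact: Q_cst.
  exact: funalg_Xrem.
apply/funext => w; rewrite !mxE mulr_natr; congr (_ - _).
by apply: eq_bigr => q _; rewrite mxE.
Qed.

End FunctionAlgebra.

(** * Proximity of multisets *)

Lemma ltr_common_lb (K : numDomainType) (d e : K) : 0 < d -> 0 < e ->
  exists f, [/\ 0 < f, f <= d & f <= e].
Proof.
move=> d0 e0; case: (real_leP (gtr0_real d0) (gtr0_real e0)) => de.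
  by exists d.
by exists e; split=> //; exact: ltW.
Qed.

(** A finite family of positive radii has a common positive lower bound. *)
Lemma seq_radius (K : numDomainType) (T : eqType) (s : seq T)
    (P : T -> K -> Prop) :
  (forall y d e, d <= e -> P y e -> P y d) ->
  (forall y, y \in s -> exists2 e, 0 < e & P y e) ->
  exists2 e, 0 < e & forall y, y \in s -> P y e.
Proof.
move=> Pmono; elim: s => [|y s IHs] Ps; first by exists 1.
have [d d0 Pd] := Ps y (mem_head _ _).
have [e e0 Pe] : exists2 e, 0 < e & forall x, x \in s -> P x e.
  by apply: IHs => x xs; apply: Ps; rewrite in_cons xs orbT.
have [f [f0 fd fe]] := ltr_common_lb d0 e0.
exists f => // x; rewrite in_cons => /predU1P [->|xs]; first exact: Pmono Pd.
exact: Pmono fe (Pe _ xs).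
Qed.

Lemma seq_separation (K : numFieldType) (s : seq K) :
  exists2 e : K, 0 < e & forall x y, x \in s -> y \in s -> `|x - y| < e -> x = y.
Proof.
have [||e e0 sep] := @seq_radius K _ s
  (fun x e => forall y, y \in s -> `|x - y| < e -> x = y).
- by move=> x d e de sep y ys xy; apply: sep => //; exact: lt_le_trans de.
- move=> x _.
  have [||e e0 sep] := @seq_radius K _ s (fun y e => `|x - y| < e -> x = y).
  + by move=> y d e de sep xy; apply: sep; exact: lt_le_trans de.
  + move=> y _; have [->|xy] := eqVneq x y; first by exists 1.
    by exists `|x - y|; rewrite ?normr_gt0 ?subr_eq0 // ltxx.
  + by exists e.
by exists e => // x y xs ys; exact: sep.
Qed.

(** Matchings are considered up to reordering; this makes the proximity of
    multisets below symmetric and transitive. *)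
Lemma all2_perm (S T : eqType) (r : S -> T -> bool) (u s : seq S) (t : seq T) :
  perm_eq u s -> all2 r u t -> exists2 v, perm_eq v t & all2 r s v.
Proof.
case: u => [|x0 u]; first by rewrite perm_sym => /perm_nilP -> ut; exists t.
case: t => [|y0 t] // us ut; set u' := x0 :: u in us ut; set t' := y0 :: t in ut *.
have sz : size u' = size t' by move: ut; rewrite all2E => /andP [/eqP].
move: us; rewrite perm_sym => /(perm_iotaP x0) [I Iperm ->].
exists [seq nth y0 t' i | i <- I].
  by rewrite (perm_trans (perm_map _ Iperm)) // sz map_nth_iota0 // take_size.
have Ilt i : i \in I -> (i < size u')%N by rewrite (perm_mem Iperm) mem_iota.
elim: I Ilt {Iperm} => //= i I IHI Ilt; rewrite IHI ?andbT => [|j jI]; last first.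
  by apply: Ilt; rewrite in_cons jI orbT.
move: ut; rewrite all2E => /andP [_ /(all_nthP (x0, y0))] /(_ i).
by rewrite size_zip -sz minnn nth_zip //=; apply; apply: Ilt; rewrite mem_head.
Qed.

(** Proximity in the matching distance: the entries of s and t can be paired at
    distance less than e.  The orientation is the one of
    [roots_from_inside], which unfolds to this relation. *)
Definition near_ms (K : numDomainType) (e : K) (s t : seq K) : Prop :=
  exists2 u, perm_eq u s & all2 (fun x y => `|x - y| < e) u t.

Section NearMultisets.
Variable K : numDomainType.
Implicit Types (d e : K) (s t u : seq K) (P : pred K).

Lemma near_ms_size e s t : near_ms e s t -> size s = size t.
Proof.
by move=> [u us]; rewrite all2E => /andP [/eqP <- _]; rewrite (perm_size us).
Qed.

Lemma near_ms_permr e s t t' : perm_eq t t' -> near_ms e s t -> near_ms e s t'.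
Proof.
move=> tt' [u us ut].
have [v vu vt] : exists2 v, perm_eq v u
    & all2 (fun y x => `|x - y| < e) t' v.
  apply: (all2_perm tt'); elim: u t ut {us tt'} => [|x u IHu] [|y t] //=.
  by case/andP => -> /IHu.
exists v; first exact: perm_trans us.
by elim: v t' vt {tt' vu} => [|x v IHv] [|y t'] //= /andP [-> /IHv].
Qed.

Lemma near_ms_sym e s t : near_ms e s t -> near_ms e t s.
Proof.
move=> [u us /(all2_perm us) [v vt sv]]; exists v => //.
elim: s v sv {us vt} => [|x s IHs] [|y v] //= /andP [xy /IHs ->].
by rewrite distrC xy.
Qed.

Lemma near_ms_trans d e s t u :
  near_ms d s t -> near_ms e t u -> near_ms (d + e) s u.
Proof.
move=> st [t']; rewrite perm_sym => t't t'u.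
have [v vs vt'] := near_ms_permr t't st; exists v => //.
elim: v t' u vt' t'u {t't vs} => [|x v IHv] [|y t'] [|a u] //=.
case/andP => xy vt' /andP [ya t'u]; rewrite (IHv t') // andbT.
by rewrite -(subrKA y); apply: le_lt_trans (ler_normD _ _) (ltrD xy ya).
Qed.

Lemma near_ms_le d e s t : d <= e -> near_ms d s t -> near_ms e s t.
Proof.
move=> de [u us ut]; exists u => //; elim: u t ut {us} => [|x u IHu] [|y t] //=.
by case/andP => xy /IHu ->; rewrite (lt_le_trans xy de).
Qed.

Lemma near_ms_filter P e s t :
  (forall x y, y \in t -> `|x - y| < e -> P x = P y) ->
  near_ms e s t -> near_ms e [seq x <- s | P x] [seq x <- t | P x].
Proof.
move=> Pt [u us ut]; exists [seq x <- u | P x]; first exact: perm_filter.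
elim: t u ut Pt {us} => [|y t IHt] [|x u] //= /andP [xy ut] Pt.
rewrite (Pt x y) ?mem_head //.
have {}ut : all2 (fun x y => `|x - y| < e) [seq x <- u | P x] [seq x <- t | P x].
  by apply: IHt => // x' y' y't; apply: Pt; rewrite in_cons y't orbT.
by case: ifP => //= _; rewrite xy.
Qed.

(** With no assumption on P, the entries t' matched to those of s satisfying P
    depend on the matching: this is all that remains for the roots in the disc
    when the limit has roots on the unit circle. *)
Lemma near_ms_filter_sub P e s t : near_ms e s t ->
  exists2 t', {subset t' <= t} & near_ms e [seq x <- s | P x] t'.
Proof.
move=> [u us ut]; exists (mask (map P u) t); first by move=> x; exact: mem_mask.
exists [seq x <- u | P x]; first exact: perm_filter.
rewrite filter_mask; elim: u t ut {us} => [|x u IHu] [|y t] //= /andP [xy /IHu].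
by case: (P x) => //=; rewrite xy.
Qed.

(** Below the separation distance of the entries, proximity is equality. *)
Lemma near_ms_sep e s t :
  (forall x y, x \in s -> y \in t -> `|x - y| < e -> x = y) ->
  near_ms e s t -> perm_eq s t.
Proof.
move=> sep [u us ut]; rewrite perm_sym in us; rewrite (permPl us).
have {}sep x y : x \in u -> y \in t -> `|x - y| < e -> x = y.
  by rewrite -(perm_mem us); exact: sep.
suff -> : u = t by [].
elim: u t ut sep {us} => [|x u IHu] [|y t] //= /andP [xy ut] sep.
rewrite (sep x y) ?mem_head // (IHu t) // => x' y' x'u y't.
by apply: sep; rewrite in_cons ?x'u ?y't orbT.
Qed.

End NearMultisets.

Lemma near_ms_eq (K : numFieldType) (s t : seq K) :
  (forall e, 0 < e -> near_ms e s t) -> perm_eq s t.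
Proof.
move=> st; have [e e0 sep] := seq_separation (s ++ t).
apply: near_ms_sep (st e e0) => x y xs yt.
by apply: sep; rewrite mem_cat ?xs ?yt ?orbT.
Qed.

(** * Continuity of the roots of a polynomial *)

Definition cvg_ms (K : numDomainType) (T : Type) (F : set_system T)
    (xs : T -> seq K) (ys : seq K) : Prop :=
  forall e, 0 < e -> \forall w \near F, near_ms e (xs w) ys.

Lemma coef_XsubCM (K : nzRingType) (x : K) (p : {poly K}) (j : nat) :
  (('X - x%:P) * p)`_j = (if j is i.+1 then p`_i else 0) - x * p`_j.
Proof. by rewrite mulrBl coefB coefXM coefCM; case: j. Qed.

(** The coefficients of (X - x) A are continuous in x and in those of A. *)
Lemma coef_prod_XsubC_cont (K : numFieldType) (t : seq K) (j : nat) (e : K) :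
  0 < e -> exists2 d, 0 < d & forall u, all2 (fun x y => `|x - y| < d) u t ->
    `|(\prod_(x <- u) ('X - x%:P))`_j - (\prod_(y <- t) ('X - y%:P))`_j| < e.
Proof.
elim: t j e => [|y t IHt] j e e0.
  by exists 1 => // -[|x u] //= _; rewrite !big_nil subrr normr0.
have e30 : 0 < e / 3 by rewrite divr_gt0.
set B := \prod_(y <- t) ('X - y%:P) in IHt *.
have [d1 d10 H1] : exists2 d, 0 < d &
    forall u, all2 (fun x y => `|x - y| < d) u t ->
    `|(if j is i.+1 then (\prod_(x <- u) ('X - x%:P))`_i else 0) -
      (if j is i.+1 then B`_i else 0)| < e / 3.
  case: j => [|i]; last exact: IHt.
  by exists 1 => // u _; rewrite subrr normr0.
have ny0 : 0 < `|y| + 1 by rewrite ltr_wpDl.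
have [d2 d20 H2] := IHt j _ (divr_gt0 e30 ny0).
have nB0 : 0 < `|B`_j| + 1 by rewrite ltr_wpDl.
(* d3 bounds |x - y| both by 1, which controls |x|, and by what the term
   (x - y) B needs. *)
have [d3 [d30 d3d d31]] := ltr_common_lb (divr_gt0 e30 nB0) (@ltr01 K).
have [d4 [d40 d41 d42]] := ltr_common_lb d10 d20.
have [d [d0 dd3 dd4]] := ltr_common_lb d30 d40.
exists d => // -[|x u] //= /andP [xy ut]; rewrite !big_cons !coef_XsubCM -/B.
set A := \prod_(x <- u) ('X - x%:P).
have near_d f : d <= f -> all2 (fun x y => `|x - y| < f) u t.
  move=> df; elim: u t ut {H1 H2 B nB0 d3d A IHt} => [|a u IHu] [|b t] //=.
  by case/andP => /lt_le_trans -> // /IHu.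
have := H1 u (near_d _ (le_trans dd4 d41)); rewrite -/A => {}H1.
have := H2 u (near_d _ (le_trans dd4 d42)); rewrite -/A => {}H2.
set a1 := (if _ is _.+1 then _ else _) in H1 *.
set b1 := (if _ is _.+1 then _ else _) in H1 *.
have -> : a1 - x * A`_j - (b1 - y * B`_j)
        = (a1 - b1) - x * (A`_j - B`_j) - (x - y) * B`_j by ring.
have eE : e = e / 3 + e / 3 + e / 3 by field.
have xle : `|x| <= `|y| + 1.
  rewrite -[x](subrK y); apply: le_trans (ler_normD _ _) _.
  rewrite addrC lerD2l (le_trans (ltW xy)) //.
  exact: le_trans dd3 d31.
have X : `|x * (A`_j - B`_j)| < e / 3.
  rewrite normrM; apply: le_lt_trans (ler_wpM2r (normr_ge0 _) xle) _.
  by rewrite mulrC -ltr_pdivlMr.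
have Y : `|(x - y) * B`_j| < e / 3.
  rewrite normrM; apply: (@le_lt_trans _ _ (`|x - y| * (`|B`_j| + 1))).
    by rewrite ler_wpM2l // lerDl.
  rewrite -ltr_pdivlMr //; apply: lt_le_trans xy _.
  exact: le_trans dd3 d3d.
rewrite [ltRHS]eE; apply: le_lt_trans (ler_normB _ _) (ltrD _ Y).
exact: le_lt_trans (ler_normB _ _) (ltrD H1 X).
Qed.

Lemma cvg_ms_coef (K : numFieldType) (T : Type) (F : set_system T)
    {FF : Filter F} (xs : T -> seq K) (ys : seq K) (j : nat) :
  cvg_ms F xs ys ->
  (fun w => (\prod_(x <- xs w) ('X - x%:P))`_j) @ F
    --> (\prod_(y <- ys) ('X - y%:P))`_j.
Proof.
move=> xsys; apply/cvgrPdist_lt => e e0.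
have [d d0 H] := coef_prod_XsubC_cont ys j e0.
apply: filterS (xsys d d0) => w [u us /H].
by rewrite (perm_big _ us) distrC.
Qed.

(** The smallest factor is at most the geometric mean: if a monic polynomial is
    small at y, then one of its roots is close to y. *)
Lemma exists_factor_le (K : numDomainType) (y : K) (s : seq K) : s != [::] ->
  exists2 x, x \in s & `|y - x| ^+ size s <= \prod_(x <- s) `|y - x|.
Proof.
elim: s => // a s IHs _; have [->|s0] := eqVneq s [::].
  by exists a; rewrite ?mem_head // big_seq1 expr1.
have [x xs xle] := IHs s0; rewrite big_cons /=.
case: (real_leP (normr_real (y - x)) (normr_real (y - a))) => xa.
  by exists x; rewrite ?in_cons ?xs ?orbT // exprS ler_pM ?exprn_ge0.
exists a; rewrite ?mem_head // exprS ler_wpM2l //; apply: le_trans xle.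
by rewrite lerXn2r ?nnegrE // ltW.
Qed.

(** Continuity of roots, by induction on the degree.  The values at a root y of
    the limit tend to 0, so a root x w tends to y ([exists_factor_le]); dividing
    out X - x w and X - y keeps the coefficients convergent, because Horner's
    scheme computes the quotient from the top coefficient downwards. *)
Lemma coef_cvg_ms (K : numFieldType) (T : Type) (F : set_system T)
    {FF : Filter F} (xs : T -> seq K) (ys : seq K) :
  (forall w, size (xs w) = size ys) ->
  (forall j, (fun w => (\prod_(x <- xs w) ('X - x%:P))`_j) @ F
    --> (\prod_(y <- ys) ('X - y%:P))`_j) ->
  cvg_ms F xs ys.
Proof.
elim: ys xs => [|y ys IHys] xs xs_size xs_cvg e e0.
  by apply: nearW => w; exists [::]; rewrite // (size0nil (xs_size w)).
have /choice [x xP] : forall w, exists x,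
    x \in xs w /\ `|y - x| ^+ (size ys).+1 <= `|(\prod_(x <- xs w) ('X - x%:P)).[y]|.
  move=> w; have [|x xin xle] := @exists_factor_le _ y (xs w).
    by rewrite -size_eq0 xs_size.
  exists x; split => //; rewrite horner_prod normr_prod -[(size ys).+1](xs_size w).
  by under eq_bigr do rewrite hornerXsubC.
have Qy : (fun w => (\prod_(x <- xs w) ('X - x%:P)).[y]) @ F --> (0 : K).
  have -> : (0 : K) = \sum_(j < (size ys).+2)
      (\prod_(x <- y :: ys) ('X - x%:P))`_j * y ^+ j.
    rewrite -horner_coef_wide ?size_prod_XsubC //.
    by rewrite big_cons hornerM hornerXsubC subrr mul0r.
  rewrite (_ : (fun w => _) = fun w => \sum_(j < (size ys).+2)
      (\prod_(x <- xs w) ('X - x%:P))`_j * y ^+ j); last first.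
    apply/funext => w; rewrite (horner_coef_wide (n := (size ys).+2)) //.
    by rewrite size_prod_XsubC xs_size.
  apply: cvg_big => [|j _]; first exact: add_continuous.
  by apply: cvgM => //; exact: cvg_cst.
have x_cvg : x @ F --> y.
  apply/cvgrPdist_lt => d d0.
  have dn : 0 < d ^+ (size ys).+1 by rewrite exprn_gt0.
  have /cvgrPdist_lt /(_ _ dn) := Qy; apply: filterS => w.
  rewrite sub0r normrN; have [_ xle] := xP w => /(le_lt_trans xle).
  by rewrite ltr_pXn2r ?nnegrE // ltW.
pose xs' w := rem (x w) (xs w).
have xsE w : perm_eq (xs w) (x w :: xs' w) by apply: perm_to_rem; case: (xP w).
have xs'_size w : size (xs' w) = size ys.
  by have := xs_size w; rewrite (perm_size (xsE w)) => -[].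
(* Horner's scheme: coefficient j of the quotient from coefficient j + 1. *)
have coefE (z : K) zs j : (\prod_(x <- zs) ('X - x%:P))`_j =
    (\prod_(x <- z :: zs) ('X - x%:P))`_j.+1 + z * (\prod_(x <- zs) ('X - x%:P))`_j.+1.
  by rewrite big_cons coef_XsubCM subrK.
(* Induction from the top coefficient, i counting the steps below it. *)
have xs'_cvg i j : (size ys < i + j)%N ->
    (fun w => (\prod_(x <- xs' w) ('X - x%:P))`_j) @ F
    --> (\prod_(x <- ys) ('X - x%:P))`_j.
  elim: i j => [|i IHi] j ij.
    rewrite nth_default ?size_prod_XsubC //.
    rewrite (_ : (fun w => _) = fun=> 0); first exact: cvg_cst.
    by apply/funext => w; rewrite nth_default // size_prod_XsubC xs'_size.
  rewrite (coefE y) (_ : (fun w => _) = fun w =>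
    (\prod_(x <- xs w) ('X - x%:P))`_j.+1
    + x w * (\prod_(x <- xs' w) ('X - x%:P))`_j.+1).
    apply: cvgD; first exact: xs_cvg.
    by apply: cvgM => //; apply: IHi; rewrite addnS -addSn.
  by apply/funext => w; rewrite (coefE (x w)) -(perm_big _ (xsE w)).
have := IHys xs' xs'_size (fun j => xs'_cvg (size ys).+1 j (leq_addr _ _)) e e0.
have /cvgr_dist_lt /(_ e e0) := x_cvg; apply: filterS2 => w yx [u us ut].
exists (x w :: u); last by rewrite /= distrC yx.
by rewrite perm_sym (perm_trans (xsE w)) // perm_cons perm_sym.
Qed.

(** * Paths of polynomials without roots on the unit circle *)

Section ComplexSegment.
Variable R : realType.
Local Notation C := (Cplx R).

(** The topology of C is given by balls whose radii are positive elements of C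
    itself, that is, images of positive reals. *)
Lemma real_complex_continuous : continuous (real_complex R : R -> C).
Proof.
move=> s; apply/cvgrPdist_lt => e e0.
have eE : e = (complex.Re e)%:C%C :> C by rewrite (RRe_real (gtr0_real e0)).
have e0' : 0 < complex.Re e by rewrite -ltcR -eE.
near=> t.
have -> : (real_complex R s : C) - real_complex R t = real_complex R (s - t).
  by rewrite rmorphB.
rewrite (normc_def (real_complex R (s - t) : R[i])) /= expr0n addr0 sqrtr_sqr.
rewrite eE ltcR; near: t.
exact: cvgr_dist_lt e0'.
Unshelve. all: by end_near. Qed.

(** The set of parameters where P holds is open and closed in [0, 1], which is
    connected. *)
Lemma segment_locally_constant (P : C -> Prop) (z0 z1 : C) :
  (forall s : R, 0 <= s <= 1 ->
    \forall w \near z0 + s%:C%C * (z1 - z0), P w <-> P (z0 + s%:C%C * (z1 - z0))) ->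
  P z0 -> P z1.
Proof.
pose gam (s : R) : C := z0 + s%:C%C * (z1 - z0).
have gam_cont s : gam @ s --> gam s.
  apply: cvgD; first exact: cvg_cst.
  apply: cvgM; last exact: cvg_cst.
  exact: real_complex_continuous.
move=> Ploc Pz0; pose I : set R := [set` `[(0 : R), 1]].
pose D (Q : C -> Prop) : set R := [set s | I s -> Q (gam s)].
have near_D (Q : C -> Prop) s : I s -> Q (gam s) ->
    (\forall w \near gam s, Q w <-> Q (gam s)) -> nbhs s (D Q).
  move=> Is Qs Qloc.
  have : \forall t \near s, Q (gam t) <-> Q (gam s) := gam_cont s _ Qloc.
  by apply: filterS => t Qt _; apply/Qt.
have near_P s : I s -> \forall w \near gam s, P w <-> P (gam s).
  by move=> Is; apply: Ploc; move: Is; rewrite /I /= in_itv.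
suff BI : [set s | I s /\ P (gam s)] = I.
  have : I 1 by rewrite /I /= in_itv /= ler01 lexx.
  by rewrite -BI => -[_]; rewrite /gam rmorph1 mul1r addrC subrK.
apply: (@segment_connected R 0 1).
- exists 0; split; first by rewrite /I /= in_itv /= ler01 lexx.
  by rewrite /gam rmorph0 mul0r addr0.
- exists (D P)^°; first exact: open_interior.
  apply/seteqP; split => s [Is Ps]; split => //.
    by apply: near_D => //; exact: near_P.
  by have := interior_subset Ps; apply.
- exists (~` (D (fun w => ~ P w))^°); first by rewrite closedC; exact: open_interior.
  apply/seteqP; split => s [Is Ps]; split => //.
    by move=> /interior_subset /(_ Is).
  apply: contrapT => nPs; apply: Ps; apply: near_D => //.
  by apply: filterS (near_P s Is) => w [wP Pw]; split => nP /=; [|]; tauto.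
Qed.

End ComplexSegment.

Lemma size_roots_mult (R : realType) (P : {poly Cplx R}) :
  P != 0 -> size (roots_mult P) = (size P).-1.
Proof.
rewrite /roots_mult; case: closed_field_poly_normal => /= s PE P0.
by rewrite PE size_scale ?lead_coef_eq0 // size_prod_XsubC.
Qed.

Lemma mem_roots_mult (R : realType) (P : {poly Cplx R}) (x : Cplx R) :
  P != 0 -> (x \in roots_mult P) = root P x.
Proof.
rewrite /roots_mult; case: closed_field_poly_normal => /= s PE P0.
by rewrite [in RHS]PE rootZ ?lead_coef_eq0 // root_prod_XsubC.
Qed.

Lemma prod_roots_mult (R : realType) (P : {poly Cplx R}) :
  P = lead_coef P *: \prod_(x <- roots_mult P) ('X - x%:P).
Proof. by rewrite /roots_mult; case: closed_field_poly_normal. Qed.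

Lemma cvg_ms_roots (R : realType) (T : Type) (F : set_system T)
    {FF : Filter F} (P : T -> {poly Cplx R}) (Q : {poly Cplx R}) :
  Q != 0 -> (forall w, size (P w) = size Q) ->
  (forall w, lead_coef (P w) = lead_coef Q) ->
  (forall j, (fun w => (P w)`_j) @ F --> Q`_j) ->
  cvg_ms F (fun w => roots_mult (P w)) (roots_mult Q).
Proof.
move=> Q0 sizeP leadP cvgP.
have P0 w : P w != 0 by rewrite -lead_coef_eq0 leadP lead_coef_eq0.
apply: coef_cvg_ms => [w|j]; first by rewrite !size_roots_mult // sizeP.
have coefE (p : {poly Cplx R}) : p != 0 ->
    (\prod_(x <- roots_mult p) ('X - x%:P))`_j = (lead_coef p)^-1 * p`_j.
  move=> p0; rewrite {3}[p]prod_roots_mult coefZ mulKf //.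
  by rewrite lead_coef_eq0.
rewrite coefE // (_ : (fun w => _) = fun w => (lead_coef Q)^-1 * (P w)`_j).
  by apply: cvgM => //; exact: cvg_cst.
by apply/funext => w; rewrite coefE // leadP.
Qed.

(** Near a limit without entries on the unit circle, no entry can cross the
    circle. *)
Lemma cvg_ms_disc (K : numFieldType) (T : Type) (F : set_system T)
    {FF : Filter F} (xs : T -> seq K) (ys : seq K) :
  (forall y, y \in ys -> `|y| != 1) -> cvg_ms F xs ys ->
  cvg_ms F (fun w => [seq x <- xs w | `|x| < 1]) [seq y <- ys | `|y| < 1].
Proof.
move=> ys1 xsys e e0.
have [||d d0 Hd] := @seq_radius K _ ys
  (fun y e => forall x, `|x - y| < e -> (`|x| < 1) = (`|y| < 1)).
- by move=> y a b ab H x xy; apply: H; exact: lt_le_trans ab.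
- move=> y /ys1 y1.
  case: (real_ltgtP (normr_real y) (@real1 K)) y1 => // y1 _.
    exists (1 - `|y|) => [|x xy]; first by rewrite subr_gt0.
    rewrite -[x](subrK y) (le_lt_trans (ler_normD _ _)) //.
    by rewrite -ltrBrDr.
  exists (`|y| - 1) => [|x xy]; first by rewrite subr_gt0.
  apply/negbTE; rewrite -real_leNgt ?normr_real ?real1 //.
  rewrite distrC in xy; rewrite -(lerD2l `|y - x|).
  have yx := ler_normD (y - x) x; rewrite subrK in yx.
  by apply: le_trans yx; rewrite -lerBrDr ltW.
have [f [f0 fe fd]] := ltr_common_lb e0 d0.
apply: filterS (xsys f f0) => w /(near_ms_filter _) H.
apply: near_ms_le fe (H _ _) => x y yys xy.
by apply: Hd => //; exact: lt_le_trans fd.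
Qed.

(** Rouche's theorem in the form used here.  As size B < size A, the degree and
    the leading coefficient are constant along the homotopy, so no root escapes
    to infinity, and none crosses the circle. *)
Lemma disc_size_affine (R : realType) (A B : {poly Cplx R}) :
  (size B < size A)%N ->
  (forall (s : R) x, 0 <= s <= 1 -> `|x| = 1 -> ~~ root (A + s%:C%C *: B) x) ->
  size [seq x <- roots_mult A | `|x| < 1]
  = size [seq x <- roots_mult (A + B) | `|x| < 1].
Proof.
move=> BA circle.
pose H (s : Cplx R) := A + s *: B.
have BsA s : (size (s *: B) < size A)%N by exact: leq_ltn_trans (size_scale_leq _ _) BA.
have sizeH s : size (H s) = size A by rewrite /H size_polyDl.
have leadH s : lead_coef (H s) = lead_coef A by rewrite /H lead_coefDl.
have H0 s : H s != 0 by rewrite -size_poly_gt0 sizeH (leq_ltn_trans _ BA).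
pose N s := size [seq x <- roots_mult (H s) | `|x| < 1].
suff : N 0 = N 1 by rewrite /N /H scale0r addr0 scale1r.
apply: (@segment_locally_constant R (fun s => N 0 = N s) 0 1) => // s s01.
rewrite add0r subr0 mulr1.
have Hcvg : cvg_ms (nbhs (s%:C%C : Cplx R)) (fun w => roots_mult (H w))
    (roots_mult (H s%:C%C)).
  apply: cvg_ms_roots => // [w|w|j]; rewrite ?sizeH ?leadH //.
  rewrite coefD coefZ (_ : (fun w => _) = fun w => A`_j + w * B`_j).
    by apply: cvgD; [exact: cvg_cst|apply: cvgM; [exact: cvg_id|exact: cvg_cst]].
  by apply/funext => w; rewrite coefD coefZ.
have Hcircle y : y \in roots_mult (H s%:C%C) -> `|y| != 1.
  rewrite mem_roots_mult // => rooty; apply/eqP => y1.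
  by have := circle s y s01 y1; rewrite rooty.
have Hdisc := cvg_ms_disc Hcircle Hcvg ltr01.
near=> w.
suff -> : N w = N s%:C%C by [].
by apply: (@near_ms_size _ 1); near: w; exact: Hdisc.
Unshelve. all: by end_near. Qed.

(** * The symbol on the unit circle *)

Section UnitCircle.
Variable R : realType.

Lemma expiD (s t : R) : expi (s + t) = expi s * expi t.
Proof.
rewrite /expi cosD sinD; apply/eqP; rewrite eq_complex /= eqxx addrC.
by rewrite [sin s * _]mulrC [X in _ + X]mulrC eqxx.
Qed.

Lemma expi0 : expi (0 : R) = 1.
Proof. by rewrite /expi cos0 sin0. Qed.

Lemma expiMn (n : nat) (t : R) : expi (n%:R * t) = expi t ^+ n.
Proof.
elim: n => [|n IHn]; first by rewrite mul0r expi0.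
by rewrite -natr1 mulrDl mul1r expiD IHn exprSr.
Qed.

Lemma norm_expi (t : R) : `|expi t| = 1.
Proof. by rewrite /expi normc_def /= cos2Dsin2 sqrtr1. Qed.

(** The stability hypothesis speaks of the points exp(i xi); this brings it to
    all complex numbers of modulus 1. *)
Lemma unit_circle_expi (x : Cplx R) : `|x| = 1 -> exists t, x = expi t.
Proof.
case: x => u v; rewrite normc_def => -[/= uv1].
have {}uv1 : u ^+ 2 + v ^+ 2 = 1.
  by rewrite -[LHS]sqr_sqrtr ?uv1 ?expr1n // addr_ge0 ?sqr_ge0.
have v2 : v ^+ 2 = 1 - u ^+ 2 by rewrite -uv1 addrC addKr.
have u1 : -1 <= u <= 1.
  rewrite -ler_norml -(@expr_le1 _ 2) // real_normK ?num_real //.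
  by rewrite -uv1 lerDl sqr_ge0.
have vE : `|v| = sin (acos u) by rewrite sin_acos // -v2 sqrtr_sqr.
case: (leP 0 v) => v0; [exists (acos u)|exists (- acos u)].
  by rewrite /expi acosK ?in_itv //= -vE ger0_norm.
by rewrite /expi cosN sinN acosK ?in_itv //= -vE ltr0_norm // opprK.
Qed.

End UnitCircle.

Section Symbol.
Variables (R : realType) (r p : nat) (a : int -> Cplx R).
Local Notation C := (Cplx R).

(** X^r times the Laurent polynomial sum a_k X^k. *)
Definition symbol_poly : {poly C} := \poly_(k < (r + p).+1) a (sidx r k).

Lemma scheme_polyE (z : C) : scheme_poly r p a z = z *: 'X^r - symbol_poly.
Proof. by rewrite /scheme_poly /symbol_poly poly_def. Qed.

Lemma sidx_right : sidx r (r + p) = p%:Z.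
Proof. by rewrite /sidx PoszD addrC addKr. Qed.

Lemma symbol_poly_circle (x : C) :
  cauchy_stable r p a -> `|x| = 1 -> `|symbol_poly.[x]| <= 1.
Proof.
move=> stable /unit_circle_expi [t ->].
have -> : symbol_poly.[expi t]
    = expi (r%:R * t) * \sum_(k < (r + p).+1) a (sidx r k) * expi ((sidx r k)%:~R * t).
  rewrite horner_poly mulr_sumr; apply: eq_bigr => k _.
  rewrite mulrCA -expiD -expiMn -mulrDl; congr (_ * expi (_ * _)).
  by rewrite /sidx rmorphB /= addrC subrK.
by rewrite normrM norm_expi mul1r.
Qed.

End Symbol.

(** * The roots of the characteristic polynomial for |z| > 1 *)

Section SchemeRoots.
Variables (R : realType) (r p : nat) (a : int -> Cplx R).
Local Notation C := (Cplx R).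
Hypotheses (r_gt0 : (0 < r)%N) (p_gt0 : (0 < p)%N).
Hypotheses (a_left : a (- r%:Z) != 0) (a_right : a p%:Z != 0).
Hypothesis stable : cauchy_stable r p a.
Local Notation P := (scheme_poly r p a).
Local Notation Q := (symbol_poly r p a).

Lemma coef_scheme_poly (z : C) (j : nat) :
  (P z)`_j = z * (j == r)%:R - Q`_j.
Proof. by rewrite scheme_polyE coefB coefZ coefXn. Qed.

Lemma size_symbol_poly : size Q = (r + p).+1.
Proof. by rewrite size_poly_eq // sidx_right. Qed.

Lemma size_scheme_poly (z : C) : size (P z) = (r + p).+1.
Proof.
rewrite scheme_polyE addrC size_polyDl size_polyN size_symbol_poly //.
apply: leq_ltn_trans (size_scale_leq _ _) _.
by rewrite size_polyXn ltnS -[X in (X < _)%N]addn0 ltn_add2l.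
Qed.

Lemma lead_coef_scheme_poly (z : C) : lead_coef (P z) = - a p%:Z.
Proof.
rewrite lead_coefE size_scheme_poly /= coef_scheme_poly coef_poly ltnSn.
by rewrite sidx_right -[X in _ == X]addn0 eqn_add2l (gtn_eqF p_gt0) mulr0 sub0r.
Qed.

Lemma scheme_poly_neq0 (z : C) : P z != 0.
Proof. by rewrite -size_poly_gt0 size_scheme_poly. Qed.

Lemma scheme_poly_root0 (z : C) : ~~ root (P z) 0.
Proof.
rewrite /root horner_coef0 coef_scheme_poly coef_poly /= (ltn_eqF r_gt0).
by rewrite mulr0 sub0r oppr_eq0 /sidx sub0r.
Qed.

(** A root x of modulus 1 would give |z| = |Q(x)| <= 1. *)
Lemma scheme_poly_circle (z x : C) : 1 < `|z| -> `|x| = 1 -> ~~ root (P z) x.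
Proof.
move=> z1 x1; rewrite scheme_polyE /root hornerD hornerN hornerZ hornerXn.
rewrite subr_eq0; apply: contraTneq z1 => zx.
have := symbol_poly_circle stable x1; rewrite -zx normrM normrX x1 expr1n mulr1.
by move=> /le_gtF ->.
Qed.

Lemma cvg_ms_roots_scheme (z : C) :
  cvg_ms (nbhs z) (fun w => roots_mult (P w)) (roots_mult (P z)).
Proof.
apply: cvg_ms_roots => [|w|w|j]; rewrite ?scheme_poly_neq0 //.
- by rewrite !size_scheme_poly.
- by rewrite !lead_coef_scheme_poly.
rewrite coef_scheme_poly (_ : (fun w => _) = fun w => w * (j == r)%:R - Q`_j).
  apply: cvgB; last exact: cvg_cst.
  by apply: cvgM; [exact: cvg_id|exact: cvg_cst].
by apply/funext => w; rewrite coef_scheme_poly.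
Qed.

Lemma cvg_ms_roots_in_disc (z : C) : 1 < `|z| ->
  cvg_ms (nbhs z) (roots_in_disc r p a) (roots_in_disc r p a z).
Proof.
move=> z1; apply: cvg_ms_disc (cvg_ms_roots_scheme z) => y.
rewrite mem_roots_mult ?scheme_poly_neq0 // => rooty; apply/eqP => y1.
by have := scheme_poly_circle z1 y1; rewrite rooty.
Qed.

(** X^r (c - u X^p) has 0 as a root of multiplicity r; its other roots satisfy
    |X|^p = |c / u| > 1. *)
Lemma size_binomial_in_disc (c u : C) : u != 0 -> `|u| < `|c| ->
  size [seq x <- roots_mult (c *: 'X^r - u *: 'X^(r + p)) | `|x| < 1] = r.
Proof.
move=> u0 uc; set E := (X in roots_mult X).
have c0 : c != 0 by rewrite -normr_gt0 (le_lt_trans _ uc).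
pose G : {poly C} := c%:P - u *: 'X^p.
have EE : E = 'X^r * G by rewrite /E /G exprD -!mul_polyC; ring.
have G0 : ~~ root G 0.
  rewrite /root /G hornerD hornerN hornerZ hornerXn hornerC expr0n.
  by rewrite (gtn_eqF p_gt0) mulr0 subr0.
have E0 : E != 0.
  rewrite EE mulf_neq0 ?expf_neq0 ?polyX_eq0 //.
  by apply: contraNneq G0 => ->; rewrite root0.
have -> : [seq x <- roots_mult E | `|x| < 1] = [seq x <- roots_mult E | x == 0].
  apply: eq_in_filter => x; rewrite mem_roots_mult //.
  have [->|x0] := eqVneq x 0; first by rewrite normr0 ltr01.
  rewrite EE rootM /root hornerXn expf_eq0 (negPf x0) andbF /=.
  rewrite /G hornerD hornerN hornerZ hornerXn hornerC subr_eq0 => /eqP cE.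
  apply: contraTF uc => x1; rewrite cE normrM normrX.
  rewrite -real_leNgt ?normr_real ?rpredM ?rpredX ?normr_real //.
  by rewrite ler_piMr // exprn_ile1 // ltW.
rewrite size_filter.
have -> : count (fun x => x == 0) (roots_mult E) = mup 0 E.
  rewrite -mu_prod_XsubC {2}[E]prod_roots_mult -mul_polyC mupMr //.
  by rewrite rootC lead_coef_eq0.
rewrite EE -['X]subr0 -[X in 'X - X]polyC0.
by rewrite mupMl ?mup_XsubCX ?eqxx ?subr0.
Qed.

(** Homotopy from P_z to (1 + c) z X^r - a_p X^(r + p), where c = |a_p|.  It is
    affine and keeps the leading coefficient - a_p.  At time t and on the unit
    circle, the term in X^r has modulus (1 + t c) |z| > 1 + t c, while the rest
    has modulus at most (1 - t) + t c. *)
Lemma size_roots_in_disc (z : C) : 1 < `|z| -> size (roots_in_disc r p a z) = r.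
Proof.
move=> z1; set c := `|a p%:Z|.
pose B := (c * z) *: 'X^r + Q - a p%:Z *: 'X^(r + p).
have c0 : 0 <= c by exact: normr_ge0.
rewrite /roots_in_disc (@disc_size_affine _ _ B).
- have -> : P z + B = ((1 + c) * z) *: 'X^r - a p%:Z *: 'X^(r + p).
    by rewrite scheme_polyE /B -!mul_polyC !(polyCM, polyCD); ring.
  apply: size_binomial_in_disc => //.
  rewrite normrM ger0_norm ?addr_ge0 //; apply: (@lt_le_trans _ _ (1 + c)).
    by rewrite -/c ltrDr.
  by rewrite ler_peMr ?addr_ge0 // ltW.
- rewrite size_scheme_poly ltnS; apply/leq_sizeP => j jn.
  rewrite /B coefB coefD !coefZ !coefXn coef_poly ltnS.
  have jr : (r < j)%N by apply: leq_trans jn; rewrite -[X in (X < _)%N]addn0 ltn_add2l.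
  rewrite (gtn_eqF jr) mulr0 add0r; move: jn; rewrite leq_eqVlt => /predU1P[<-|nj].
    by rewrite leqnn eqxx mulr1 sidx_right subrr.
  by rewrite leqNgt nj (gtn_eqF nj) mulr0 subr0.
move=> s x /andP [s0 s1] x1.
have [s0' s1'] : 0 <= s%:C%C :> C /\ 0 <= 1 - s%:C%C :> C.
  split; first by rewrite ler0c.
  by rewrite subr_ge0 -(rmorph1 (real_complex R)) lecR.
set t : C := s%:C%C in s0' s1' *.
have -> : P z + t *: B = ((1 + t * c) * z) *: 'X^r
    - ((1 - t) *: Q + (t * a p%:Z) *: 'X^(r + p)).
  by rewrite scheme_polyE /B -!mul_polyC !(polyCM, polyCB, polyCD); ring.
rewrite /root !(hornerD, hornerN, hornerZ, hornerXn) subr_eq0.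
apply/eqP => /(congr1 Num.norm); rewrite !normrM normrX x1 expr1n mulr1.
move=> zE; have : `|(1 - t) * Q.[x] + t * a p%:Z * x ^+ (r + p)| <= 1 + t * c.
  apply: le_trans (ler_normD _ _) _; rewrite !normrM normrX x1 expr1n mulr1.
  rewrite (ger0_norm s0') (ger0_norm s1') lerD //.
  apply: (@le_trans _ _ (1 - t)); last by rewrite gerBl.
  by rewrite ler_piMr // symbol_poly_circle.
have tc0 : 0 < 1 + t * c by rewrite ltr_wpDr ?mulr_ge0.
by rewrite -zE (gtr0_norm tc0) (ger_pMr _ tc0) => /le_gtF; rewrite z1.
Qed.

End SchemeRoots.

(** * A chart of the exterior of the disc at a boundary point *)

(** For |z| = 1, this Moebius map sends the half-plane Re t > 0 to the exterior
    of the unit disc (with t = 1 going to infinity), and 0 to z.  The exterior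
    of the disc is not convex near z, but its preimage, intersected with a small
    ball, is: this gives connected half-neighbourhoods of z. *)
Definition half_chart (K : fieldType) (z t : K) : K := z * (1 + t) / (1 - t).

Definition half_chart_inv (K : fieldType) (z w : K) : K := (w - z) / (w + z).

Section HalfPlaneChart.
Variable K : numFieldType.
Implicit Types z t w : K.

Lemma half_chart_gt1 z t : `|z| = 1 -> t != 1 ->
  (1 < `|half_chart z t|) = (`|1 - t| < `|1 + t|).
Proof.
move=> z1 t1; rewrite /half_chart !normrM normfV z1 mul1r.
by rewrite ltr_pdivlMr ?mul1r // normr_gt0 subr_eq0 eq_sym.
Qed.

Lemma half_chart_invK z w : z != 0 -> w + z != 0 ->
  half_chart_inv z w != 1 /\ half_chart z (half_chart_inv z w) = w.
Proof.
move=> z0 wz; have t1 : 1 - half_chart_inv z w = 2 * z / (w + z).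
  by rewrite /half_chart_inv; field.
have t10 : 1 - half_chart_inv z w != 0.
  by rewrite t1 !mulf_neq0 ?invr_eq0 // pnatr_eq0.
split; first by rewrite eq_sym -subr_eq0.
by rewrite /half_chart t1 /half_chart_inv; field; rewrite z0 wz.
Qed.

Lemma cvg_half_chart (T : Type) (F : set_system T) {FF : Filter F}
    (f : T -> K) z t :
  t != 1 -> f @ F --> t -> (fun x => half_chart z (f x)) @ F --> half_chart z t.
Proof.
move=> t1 ft; apply: cvgM.
  by apply: cvgM; [exact: cvg_cst|apply: cvgD; [exact: cvg_cst|exact: ft]].
apply: cvgV; first by rewrite subr_eq0 eq_sym.
by apply: cvgB; [exact: cvg_cst|exact: ft].
Qed.

Lemma cvg_half_chart_inv (T : Type) (F : set_system T) {FF : Filter F}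
    (f : T -> K) z :
  z != 0 -> f @ F --> z -> (fun x => half_chart_inv z (f x)) @ F --> (0 : K).
Proof.
move=> z0 fz; have -> : 0 = (z - z) / (z + z) by rewrite subrr mul0r.
apply: cvgM.
  by apply: cvgB; [exact: fz|exact: cvg_cst].
apply: cvgV; last by apply: cvgD; [exact: fz|exact: cvg_cst].
by rewrite -mulr2n -mulr_natr mulf_neq0 // pnatr_eq0.
Qed.

End HalfPlaneChart.

Lemma Re_gt0_norm (R : realType) (t : Cplx R) :
  (0 < complex.Re t) = (`|1 - t| < `|1 + t|).
Proof.
rewrite -[RHS](@ltr_pXn2r _ 2) ?nnegrE ?normr_ge0 // -!add_Re2_Im2 ltcR.
case: t => u v /=.
by apply/idP/idP; nra.
Qed.

(** Both s' and t' approximate s, the latter through t; drawn from a common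
    separated set, they are equal. *)
Lemma near_ms_stable (K : numFieldType) (e d : K) (ys s t s' t' : seq K) :
  (forall x y, x \in ys -> y \in ys -> `|x - y| < d -> x = y) -> 3 * e <= d ->
  {subset s' <= ys} -> {subset t' <= ys} ->
  near_ms e s t -> near_ms e t t' -> near_ms e s s' -> near_ms e s t'.
Proof.
move=> sep ed s'ys t'ys st tt' ss'.
apply: near_ms_permr (ss'); apply: (near_ms_sep (e := d)).
  by move=> x y /s'ys xys /t'ys yys; exact: sep.
apply: near_ms_le (near_ms_trans (near_ms_sym ss') (near_ms_trans st tt')).
by apply: le_trans ed; rewrite le_eqVlt; apply/orP; left; apply/eqP; ring.
Qed.

Lemma cvg_ms_unique (K : numFieldType) (T : Type) (F : set_system T)
    {FF : ProperFilter F} (xs : T -> seq K) (s t : seq K) :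
  cvg_ms F xs s -> cvg_ms F xs t -> perm_eq s t.
Proof.
move=> xss xst; apply: near_ms_eq => e e0.
have e20 : 0 < e / 2 by rewrite divr_gt0.
have [w [ws wt]] : exists w, near_ms (e / 2) (xs w) s /\ near_ms (e / 2) (xs w) t.
  exact: (@filter_ex _ F) (filterI (xss _ e20) (xst _ e20)).
by rewrite [e](splitr e); apply: near_ms_trans wt; exact: near_ms_sym.
Qed.

Lemma within_outside_proper (R : realType) (z : Cplx R) : 1 <= `|z| ->
  ProperFilter (within [set w : Cplx R | 1 < `|w|] (nbhs z)).
Proof.
move=> z1; apply: Build_ProperFilter_ex => /= A.
rewrite /within /= => /nbhs_ballP [e e0 eA].
have z0 : 0 < `|z| by exact: lt_le_trans z1.
(* z (1 + h) is a point outside the disc at distance e / 2 from z. *)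
pose h := e / (2 * `|z|); have h0 : 0 < h by rewrite divr_gt0 ?mulr_gt0.
exists (z * (1 + h)); apply: eA.
  rewrite /ball /= mulrDr mulr1 opprD addrA subrr sub0r normrN normrM.
  rewrite (gtr0_norm h0) /h invfM mulrCA [_ / `|z|]mulrC mulrA.
  rewrite [X in X < _](_ : _ = e / 2); last by field; rewrite ?gt_eqF.
  by rewrite ltr_pdivrMr // ltr_pMr // ltr1n.
rewrite /= normrM [`|1 + h|]gtr0_norm ?addr_gt0 //.
by rewrite (lt_le_trans (_ : 1 < 1 + h)) ?ltrDl // ler_peMl // addr_ge0 // ltW.
Qed.

(** * Limits of the roots at the boundary *)

Lemma half_ball_convex (R : realType) (d t0 t1 : Cplx R) (s : R) :
  0 <= s <= 1 -> `|t0| < d /\ 0 < complex.Re t0 ->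
  `|t1| < d /\ 0 < complex.Re t1 ->
  let t := t0 + s%:C%C * (t1 - t0) in `|t| < d /\ 0 < complex.Re t.
Proof.
move=> /andP [s0 s1] [t0d Ret0] [t1d Ret1]; split; last first.
  case: t0 Ret0 {t0d} => u0 v0 /= u0_gt0; case: t1 Ret1 {t1d} => u1 v1 /= u1_gt0.
  by case: (leP u0 u1) => u01; nra.
have s0' : 0 <= s%:C%C :> Cplx R by rewrite ler0c.
have s1' : 0 <= 1 - s%:C%C :> Cplx R.
  by rewrite subr_ge0 -(rmorph1 (real_complex R)) lecR.
set c : Cplx R := s%:C%C in s0' s1' *.
(* C is only partially ordered, but norms are real, hence comparable: M is the
   larger one. *)
have [M [t0M t1M Md]] : exists M, [/\ `|t0| <= M, `|t1| <= M & M < d].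
  case: (real_leP (normr_real t0) (normr_real t1)) => t01.
    by exists `|t1|.
  by exists `|t0|; split=> //; exact: ltW.
apply: le_lt_trans Md; have -> : t0 + c * (t1 - t0) = (1 - c) * t0 + c * t1 by ring.
have -> : M = (1 - c) * M + c * M by ring.
apply: le_trans (ler_normD _ _) _; rewrite !normrM (ger0_norm s0') (ger0_norm s1').
by rewrite lerD // ler_wpM2l.
Qed.

Section BoundaryLimit.
Variables (R : realType) (r p : nat) (a : int -> Cplx R).
Local Notation C := (Cplx R).
Hypotheses (r_gt0 : (0 < r)%N) (p_gt0 : (0 < p)%N).
Hypotheses (a_left : a (- r%:Z) != 0) (a_right : a p%:Z != 0).
Hypothesis stable : cauchy_stable r p a.
Local Notation P := (scheme_poly r p a).
Local Notation disc := (roots_in_disc r p a).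
Local Notation outside := [set w : C | 1 < `|w|].

(** Let e be a third of the separation distance of the roots of P_z.  For w near
    z with |w| > 1, the roots in the disc are e-close to some sub-multiset of
    the roots of P_z ([near_ms_filter_sub]).  In the chart, being e-close to a
    given one is a locally constant property of w ([near_ms_stable]), hence
    constant on a half-ball. *)
Lemma exists_roots_from_inside (z : C) : `|z| = 1 ->
  exists2 s, {subset s <= roots_mult (P z)} & roots_from_inside r p a z s.
Proof.
move=> z1; set ys := roots_mult (P z).
have z0 : z != 0 by rewrite -normr_gt0 z1.
have [d d0 sep] := seq_separation ys.
pose e := d / 3; have e0 : 0 < e by rewrite divr_gt0.
have e3 : 3 * e <= d by rewrite /e mulrC divfK // pnatr_eq0.
pose phi := half_chart z.
have phi_cvg t : t != 1 -> phi @ (t : C) --> phi t.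
  by move=> t1; exact: (@cvg_half_chart C C (nbhs t) _ id z t t1 cvg_id).
have phi0 : phi 0 = z by rewrite /phi /half_chart addr0 subr0 divr1 mulr1.
have [dl [dl0 dl1 near_ys]] : exists dl : C, [/\ 0 < dl, dl <= 1 &
    forall t, `|t| < dl -> near_ms e (roots_mult (P (phi t))) ys].
  have H : \forall t \near (0 : C), near_ms e (roots_mult (P (phi t))) ys.
    have cz : phi @ (0 : C) --> z.
      by rewrite -[X in _ --> X]phi0; apply: phi_cvg; rewrite eq_sym oner_neq0.
    have Hz := cz _ (cvg_ms_roots_scheme r p_gt0 a_right z e0).
    exact: Hz.
  have /nbhs_normP [dl' /= dl'0 Hdl] := H.
  have [dl [? ? ?]] := ltr_common_lb dl'0 (@ltr01 C).
  exists dl; split => // t tdl; apply: Hdl => /=.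
  by rewrite sub0r normrN; apply: lt_le_trans tdl _.
have tn1 t : `|t| < dl -> t != 1.
  by apply: contraTneq => ->; rewrite normr1 (le_gtF dl1).
have near_sub t : `|t| < dl -> exists2 s, {subset s <= ys} & near_ms e (disc (phi t)) s.
  by move=> /near_ys; exact: near_ms_filter_sub.
pose H (t : C) := `|t| < dl /\ 0 < complex.Re t.
have HU t : H t -> 1 < `|phi t|.
  by move=> [tdl Ret]; rewrite half_chart_gt1 ?tn1 // -Re_gt0_norm.
(* H is the half-ball on which the sub-multiset will be shown constant. *)
have [t0 Ht0] : exists t0, H t0.
  exists (dl / 2); split.
    by rewrite gtr0_norm ?divr_gt0 // ltr_pdivrMr // ltr_pMr // ltr1n.
  have : 0 < dl / 2 by rewrite divr_gt0.
  by rewrite ltcE => /andP [].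
have [s0 s0ys near0] := near_sub t0 (proj1 Ht0).
have const t : H t -> near_ms e (disc (phi t)) s0.
  move=> Ht; apply: (@segment_locally_constant R
    (fun t => near_ms e (disc (phi t)) s0) t0 t) => // s s01.
  have := half_ball_convex s01 Ht0 Ht; set u : C := t0 + _ => /= Hu.
  have near_disc : \forall t' \near u, near_ms e (disc (phi t')) (disc (phi u)).
    have near_u := cvg_ms_roots_in_disc p_gt0 a_right stable (HU _ Hu) e0.
    exact: (phi_cvg u (tn1 _ (proj1 Hu)) _ near_u).
  have near_ball : \forall t' \near u, `|t'| < dl.
    apply/nbhs_normP; exists (dl - `|u|); first by rewrite /= subr_gt0; case: Hu.
    move=> t' /=; rewrite ltrBrDl distrC => tu; apply: le_lt_trans tu.
    by have := ler_normD u (t' - u); rewrite addrC subrK.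
  near=> t'.
  have t'u : near_ms e (disc (phi t')) (disc (phi u)) by near: t'.
  have [|s' s'ys near'] := near_sub t'; first by near: t'.
  have [s'' s''ys near''] := near_sub u (proj1 Hu).
  split => [t's0|us0].
    exact: (near_ms_stable sep e3 s''ys s0ys (near_ms_sym t'u)).
  exact: (near_ms_stable sep e3 s'ys s0ys t'u).
(* Closer to z, a better approximation may come with another sub-multiset s';
   it lies within 2 e of s0, so it is s0. *)
exists s0 => // f f0.
have [g [g0 gf ge]] := ltr_common_lb f0 e0.
have near_psi : \forall w \near z, `|half_chart_inv z w| < dl.
  have psi_cvg : half_chart_inv z @ z --> (0 : C).
    exact: (@cvg_half_chart_inv C C (nbhs z) _ id z z0 cvg_id).
  have /cvgr_dist_lt /(_ _ dl0) := psi_cvg.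
  by apply: filterS => w; rewrite sub0r normrN.
have near_z : \forall w \near z, `|z - w| < 1.
  by apply/nbhs_normP; exists 1; rewrite /= ?ltr01.
have near_g := cvg_ms_roots_scheme r p_gt0 a_right z g0.
rewrite near_withinE; near=> w => w1.
have wz : w + z != 0.
  apply: contraTneq (_ : `|z - w| < 1) => [/eqP|]; last by near: w.
  rewrite addr_eq0 => /eqP ->; rewrite opprK -mulr2n normrMn z1.
  by rewrite -real_leNgt ?ler1n ?realn ?real1.
have [psi1 psiK] := half_chart_invK z0 wz.
have Hw : H (half_chart_inv z w).
  split; first by near: w.
  by rewrite Re_gt0_norm -(half_chart_gt1 z1 psi1) psiK.
have := const _ Hw; rewrite /phi psiK => ws0.
have [|s' s'ys ws'] := @near_ms_filter_sub _ (fun x => `|x| < 1) g (roots_mult (P w)) ys.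
  by near: w.
apply: near_ms_le gf _; apply: near_ms_permr (ws').
apply: (near_ms_sep (e := d)).
  by move=> x y /s'ys xys /s0ys yys; exact: sep.
apply: near_ms_le (near_ms_trans (near_ms_sym ws') ws0).
apply: le_trans e3; apply: (@le_trans _ _ (e + e)); first by rewrite lerD2r.
by have -> : 3 * e = e + e + e; [ring|rewrite lerDl ltW].
Unshelve. all: by end_near. Qed.

End BoundaryLimit.

(** * Derivative of a polynomial factor *)

Lemma coef_modp_mul (K : fieldType) (p q S : {poly K}) (n j : nat) :
  (size p <= n)%N ->
  ((p * q) %% S)`_j = \sum_(i < n) p`_i * (('X^i * q) %% S)`_j.
Proof.
move=> pn; have {1}-> : p = \sum_(i < n) p`_i *: 'X^i.
  rewrite -poly_def; apply/polyP => i; rewrite coef_poly; case: ltnP => // ni.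
  by rewrite nth_default // (leq_trans pn).
rewrite mulr_suml (big_morph (fun q => q %% S) (modpD S) (mod0p S)) coef_sum.
by apply: eq_bigr => i _; rewrite -scalerAl modpZl coefZ.
Qed.

Definition cvg_at (K : numFieldType) (F : set_system K) (z : K) (f : K -> K) :=
  f @ F --> f z.

Section LimitAlgebra.
Variables (K : numFieldType) (F : set_system K) (FF : Filter F) (z : K).

Lemma cvg_at_cst (c : K) : cvg_at F z (fun=> c).
Proof. exact: cvg_cst. Qed.

Lemma cvg_atD (f g : K -> K) :
  cvg_at F z f -> cvg_at F z g -> cvg_at F z (fun w => f w + g w).
Proof. by move=> cf cg; apply: cvgD. Qed.

Lemma cvg_atM (f g : K -> K) :
  cvg_at F z f -> cvg_at F z g -> cvg_at F z (fun w => f w * g w).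
Proof. by move=> cf cg; apply: cvgM. Qed.

End LimitAlgebra.

(** S w is a moving monic factor, of constant degree, of the polynomial
    S z T + (w - z) D.  Reducing (S w - S z) T = (w - z) D modulo S w gives the
    linear system d w M w = (w - z) v w for the increment d w of the
    coefficients: M w is the matrix of the multiplication by T modulo S w, and
    v w the remainder of D. *)
Section FactorDerivative.
Variables (K : numFieldType) (S : K -> {poly K}) (T D : {poly K}) (r : nat).
Variable z : K.
Hypothesis r_gt0 : (0 < r)%N.
Hypothesis S_factor : \forall w \near z,
  [/\ S w \is monic, size (S w) = r.+1 & S w %| S z * T + (w - z) *: D].
Hypothesis S_cont : forall j, (fun w => (S w)`_j) @ z --> (S z)`_j.
Hypothesis S_T_coprime : coprimep (S z) T.

Let rem w q j := Xrem r (fun i => (S w)`_i) q j.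
Let M w : 'M[K]_r :=
  \matrix_(i, j) \sum_(k < size T) T`_k * rem w (k + i) j.
Let v w : 'rV[K]_r := \row_j \sum_(k < size D) D`_k * rem w k j.
Let d w : 'rV[K]_r := \row_j ((S w)`_j - (S z)`_j).
Let G w : 'rV[K]_r := (\det (M w))^-1 *: (v w *m \adj (M w)).

Let Sz : S z \is monic /\ size (S z) = r.+1.
Proof. by have [? ? _] := nbhs_singleton S_factor. Qed.

Let mul_M w (u : 'rV[K]_r) (j : 'I_r) : S w \is monic -> size (S w) = r.+1 ->
  (u *m M w) 0 j = ((rVpoly u * T) %% S w)`_j.
Proof.
move=> Sw_monic Sw_size; rewrite (coef_modp_mul _ _ _ (size_poly r _)) mxE.
apply: eq_bigr => i _; rewrite coef_rVpoly_ord mxE; congr (_ * _).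
rewrite mulrC (coef_modp_mul _ _ _ (leqnn _)); apply: eq_bigr => k _.
by rewrite /rem XremE // exprD.
Qed.

(** A polynomial V of degree less than r in the kernel has S z | V T, hence
    S z | V by coprimality. *)
Let M_unit : M z \in unitmx.
Proof.
have [Sz_monic Sz_size] := Sz.
rewrite -row_free_unit -kermx_eq0; apply/rowV0P => u /sub_kermxP uM.
suff u0 : rVpoly u = 0 by rewrite -[u]rVpolyK u0 linear0.
have : S z %| rVpoly u * T.
  apply/eqP/polyP => j; rewrite coef0; case: (ltnP j r) => jr.
    by rewrite -(mul_M u (Ordinal jr)) // uM mxE.
  by rewrite nth_default // (leq_trans _ jr) // -ltnS -Sz_size ltn_modp monic_neq0.
rewrite Gauss_dvdpl // => Su; apply: contraTeq Su => u0.
by rewrite gtNdvdp // Sz_size ltnS size_poly.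
Qed.

Let key : \forall w \near z, d w *m M w = (w - z) *: v w.
Proof.
apply: filterS S_factor => w [Sw_monic Sw_size Sw_dvd].
have [Sz_monic Sz_size] := Sz.
have dE : rVpoly (d w) = S w - S z.
  apply/polyP => i; rewrite coef_rVpoly coefB; case: insubP => [j _ <-|].
    by rewrite mxE.
  rewrite -leqNgt leq_eqVlt => /predU1P [<-|ri].
    move/monicP: Sw_monic; move/monicP: Sz_monic.
    by rewrite !lead_coefE Sw_size Sz_size /= => -> ->; rewrite subrr.
  by rewrite !nth_default ?subrr // ?Sw_size ?Sz_size.
have -> : d w *m M w = \row_j (((w - z) *: D) %% S w)`_j.
  apply/rowP => j; rewrite mul_M // mxE dE.
  suff -> : ((S w - S z) * T) %% S w = ((w - z) *: D) %% S w by [].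
  apply/eqP; rewrite -subr_eq0 -modpN -modpD -/(S w %| _).
  have -> : (S w - S z) * T - (w - z) *: D
          = T * S w - (S z * T + (w - z) *: D) by ring.
  by rewrite dvdp_sub ?dvdp_mulIr.
apply/rowP => j; rewrite !mxE modpZl coefZ -{1}[D]mulr1; congr (_ * _).
rewrite (coef_modp_mul _ _ _ (leqnn _)); apply: eq_bigr => k _.
by rewrite mulr1 /rem XremE.
Qed.

Let cts := cvg_at (nbhs z) z.
Let cts_cst : forall c, cts (fun=> c) := @cvg_at_cst K (nbhs z) _ z.
Let cts_add := @cvg_atD K (nbhs z) _ z.
Let cts_mul := @cvg_atM K (nbhs z) _ z.

Let cts_rem q j : cts (fun w => rem w q j).
Proof.
have H := @funalg_Xrem K K cts cts_cst cts_add cts_mul r q j (fun w i => (S w)`_i) S_cont.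
exact H.
Qed.

Let cts_M i j : cts (fun w => M w i j).
Proof.
rewrite (_ : (fun w => _)
  = fun w => \sum_(k < size T) T`_k * rem w (k + i) j); last first.
  by apply/funext => w; rewrite mxE.
by apply: (funalg_sum cts_cst cts_add) => k; apply: cts_mul;
  [exact: cts_cst|exact: cts_rem].
Qed.

Let cts_G j : cts (fun w => G w 0 j).
Proof.
have det0 : \det (M z) != 0 by rewrite -unitfE -unitmxE.
have cts_det := funalg_det cts_cst cts_add cts_mul cts_M.
rewrite (_ : (fun w => _) = fun w => (\det (M w))^-1 * \sum_(i < r)
    (\sum_(k < size D) D`_k * rem w k i)
    * ((-1) ^+ (j + i) * \det (row' j (col' i (M w))))); last first.
  apply/funext => w; rewrite !mxE; congr (_ * _).
  by apply: eq_bigr => i _; rewrite !mxE.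
apply: cts_mul; first exact: (@cvgV _ _ _ _ _ _ det0 cts_det).
apply: (funalg_sum cts_cst cts_add) => i; apply: cts_mul.
  by apply: (funalg_sum cts_cst cts_add) => k; apply: cts_mul;
  [exact: cts_cst|exact: cts_rem].
apply: cts_mul; first exact: cts_cst.
apply: (funalg_det cts_cst cts_add cts_mul) => k l.
rewrite (_ : (fun w => _) = fun w => M w (lift j k) (lift i l)) //.
by apply/funext => w; rewrite !mxE.
Qed.

Let d_G : \forall w \near z, d w = (w - z) *: G w.
Proof.
have det0 : \det (M z) != 0 by rewrite -unitfE -unitmxE.
have near_det : \forall w \near z, \det (M w) != 0.
  have cts_det : cts (fun w => \det (M w)) := funalg_det cts_cst cts_add cts_mul cts_M.
  have n0 : 0 < `|\det (M z)| by rewrite normr_gt0.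
  have /cvgr_dist_lt /(_ _ n0) := cts_det; apply: filterS => w.
  by apply: contraTneq => ->; rewrite subr0 ltxx.
apply: filterS2 near_det key => w detw /(congr1 (fun A => A *m \adj (M w))).
rewrite -mulmxA mul_mx_adj mul_mx_scalar -scalemxAl => dE.
by rewrite /G scalerA mulrC -scalerA -dE scalerA mulVf // scale1r.
Qed.

Lemma derivable_factor_coef (j : nat) : derivable (fun w => (S w)`_j) z 1.
Proof.
case: (ltnP j r) => jr; last first.
  (* The coefficients of index at least r of a monic polynomial of degree r do
     not vary. *)
  apply: near_eq_derivable (derivable_cst ((S z)`_j) z 1).
  apply: filterS S_factor => w [Sw_monic Sw_size _]; have [Sz_monic Sz_size] := Sz.
  move: jr; rewrite leq_eqVlt => /predU1P [<-|rj].
    move/monicP: Sw_monic; move/monicP: Sz_monic.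
    by rewrite !lead_coefE Sw_size Sz_size /= => -> ->.
  by rewrite !nth_default ?Sw_size ?Sz_size.
apply/cvg_ex; exists (G z 0 (Ordinal jr)).
have shift_cvg : (fun h : K => h *: (1 : K) + z) @ (0 : K)^' --> z.
  rewrite (_ : (fun h => _) = fun h => h + z); last first.
    by apply/funext => h; rewrite [h *: 1]mulr1.
  have shift0 : (fun h : K => h + z) @ (0 : K) --> 0 + z.
    exact: (cvgD cvg_id (@cvg_cst K z K (nbhs (0 : K)) _)).
  by rewrite add0r in shift0; exact: cvg_within_filter.
have G_cvg : (fun h : K => G (h *: (1 : K) + z) 0 (Ordinal jr)) @ (0 : K)^'
    --> G z 0 (Ordinal jr).
  have Gz : (fun w => G w 0 (Ordinal jr)) @ z --> G z 0 (Ordinal jr).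
    exact: (@cts_G (Ordinal jr)).
  exact: (cvg_comp _ _ shift_cvg Gz).
apply: (cvg_trans _ G_cvg); apply: near_eq_cvg; near=> h => /=.
have h0 : h != 0 by near: h; exact: nbhs_dnbhs_neq.
have : d (h *: 1 + z) = (h *: 1 + z - z) *: G (h *: 1 + z).
  by near: h; exact: (shift_cvg _ d_G).
move=> /rowP /(_ (Ordinal jr)); rewrite mxE [in RHS]mxE /= addrK.
by move=> ->; rewrite [h *: 1]mulr1 /GRing.scale /= mulKf.
Unshelve. all: by end_near. Qed.

End FactorDerivative.

(** * Regularity of the determinant *)

(** Regular extension: near z, every value g w is itself a limit of values taken
    on A near w, hence near z. *)
Lemma cvg_within_closure (K : numFieldType) (A B : set K) (g : K -> K) :
  (forall z, B z -> ProperFilter (within A (nbhs z))) ->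
  (forall z, B z -> g @ within A (nbhs z) --> g z) ->
  forall z, B z -> g @ within B (nbhs z) --> g z.
Proof.
move=> A_proper A_cvg z Bz; apply/cvgrPdist_lt => e e0.
have e20 : 0 < e / 2 by rewrite divr_gt0.
have near_z : \forall w \near z, A w -> `|g z - g w| < e / 2.
  have /cvgrPdist_lt /(_ _ e20) := A_cvg z Bz.
  by rewrite near_withinE.
have : \forall w \near z, \forall w' \near w, A w' -> `|g z - g w'| < e / 2.
  exact/near_join.
rewrite near_withinE; apply: filterS => w near_w Bw.
have /cvgrPdist_lt /(_ _ e20) := A_cvg w Bw; rewrite near_withinE => near_w'.
have PF := A_proper w Bw.
have : within A (nbhs w) (fun w' => `|g z - g w'| < e / 2 /\ `|g w - g w'| < e / 2).
  by apply: filterS2 near_w near_w' => w' zw' ww' Aw'; split; [exact: zw'|exact: ww'].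
move=> /filter_ex [w' [zw' ww']].
rewrite -(subrKA (g w')) [e]splitr; apply: le_lt_trans (ler_normD _ _) _.
by rewrite ltrD // distrC.
Qed.

Lemma derivable_reduced_det (K : numFieldType) (r m : nat) (B : 'M[K]_(r, m))
    (s : K -> nat -> K) (z : K) :
  (forall j, derivable (fun w => s w j) z 1) ->
  derivable (fun w => reduced_det B w (s w)) z 1.
Proof.
apply: (funalg_reduced_det (Q := fun f : K -> K => derivable f z 1)).
- by move=> c; exact: derivable_cst.
- by move=> f g df dg; exact: derivableD.
- by move=> f g df dg; exact: derivableM.
- exact: derivable_id.
Qed.

Lemma cvg_at_reduced_det (K : numFieldType) (r m : nat) (B : 'M[K]_(r, m))
    (s : K -> nat -> K) (F : set_system K) (FF : Filter F) (z : K) :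
  F --> z -> (forall j, (fun w => s w j) @ F --> s z j) ->
  (fun w => reduced_det B w (s w)) @ F --> reduced_det B z (s z).
Proof.
move=> Fz Fs.
exact: (funalg_reduced_det (@cvg_at_cst K F FF z) (@cvg_atD K F FF z)
  (@cvg_atM K F FF z) B Fz Fs).
Qed.

Section Determinant.
Variables (R : realType) (r p m : nat).
Variables (a : int -> Cplx R) (b : int -> 'I_m -> Cplx R).
Local Notation C := (Cplx R).
Hypotheses (r_gt0 : (0 < r)%N) (p_gt0 : (0 < p)%N).
Hypotheses (a_left : a (- r%:Z) != 0) (a_right : a p%:Z != 0).
Hypothesis stable : cauchy_stable r p a.
Local Notation P := (scheme_poly r p a).
Local Notation disc := (roots_in_disc r p a).
Local Notation outside := [set w : C | 1 < `|w|].
Local Notation ks := (kappas r p a).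

Lemma kappas_outside (z : C) : 1 < `|z| -> ks z = disc z.
Proof. by rewrite /kappas => ->. Qed.

(** For |z| > 1 this is the continuity of the roots in the disc, so that both
    branches of the definition of [kappas] satisfy the same limit property. *)
Lemma kappas_from_inside (z : C) : 1 <= `|z| -> roots_from_inside r p a z (ks z).
Proof.
rewrite le_eqVlt => /predU1P [z1|z1].
  rewrite /kappas -z1 ltxx; apply: (xgetPex [::]).
  have [s _ zs] := exists_roots_from_inside p_gt0 a_right stable (esym z1).
  by exists s.
rewrite kappas_outside // => e e0.
apply: cvg_within.
exact: (cvg_ms_roots_in_disc p_gt0 a_right stable z1 e0).
Qed.

Lemma kappas_cvg (z : C) : 1 <= `|z| ->
  cvg_ms (within outside (nbhs z)) ks (ks z).
Proof.
move=> z1 e e0; have := kappas_from_inside z1 e0; rewrite !near_withinE.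
by apply: filterS => w near_w w1; rewrite kappas_outside //; exact: near_w.
Qed.

Lemma size_kappas (z : C) : 1 <= `|z| -> size (ks z) = r.
Proof.
move=> z1; have PF := within_outside_proper z1.
have : within outside (nbhs z) (fun w => near_ms 1 (ks w) (ks z) /\ 1 < `|w|).
  have := kappas_cvg z1 ltr01; rewrite near_withinE.
  by apply: filterS => w near_w w1; split => //; exact: near_w.
move=> /filter_ex [w [/near_ms_size <- w1]].
by rewrite kappas_outside // size_roots_in_disc.
Qed.

Lemma kappas_root (z x : C) : 1 <= `|z| -> x \in ks z -> root (P z) x.
Proof.
rewrite -(mem_roots_mult _ (scheme_poly_neq0 r p_gt0 a_right z)).
rewrite le_eqVlt => /predU1P [z1|z1]; last first.
  by rewrite kappas_outside // mem_filter => /andP [].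
have [s s_sub zs] := exists_roots_from_inside p_gt0 a_right stable (esym z1).
have z1' : 1 <= `|z| by rewrite -z1.
have PF := within_outside_proper z1'.
rewrite (perm_mem (cvg_ms_unique (kappas_from_inside z1') zs)).
exact: s_sub.
Qed.

Lemma kappas_neq0 (z : C) : 1 <= `|z| -> 0 \notin ks z.
Proof.
move=> z1; apply/negP => /(kappas_root z1) root0.
by have := scheme_poly_root0 p r_gt0 a_left z; rewrite root0.
Qed.

Definition stable_factor (z : C) : {poly C} := \prod_(x <- ks z) ('X - x%:P).

Lemma KL_detE (z : C) : 1 <= `|z| ->
  KL_det r p a b z
  = reduced_det (boundary_mx r p a b) z (fun j => (stable_factor z)`_j).
Proof.
move=> z1; apply: mode_det_reduce.
- exact: pchar_num.
- exact: size_kappas.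
- exact: r_gt0.
- exact: kappas_neq0.
Qed.

Lemma stable_factor_cvg (j : nat) (z : C) : 1 <= `|z| ->
  (fun w => (stable_factor w)`_j) @ within outside (nbhs z)
  --> (stable_factor z)`_j.
Proof. by move=> z1; apply: cvg_ms_coef; exact: kappas_cvg. Qed.

Lemma near_outside (z : C) : 1 < `|z| -> \forall w \near z, 1 < `|w|.
Proof.
move=> z1; apply/nbhs_normP; exists (`|z| - 1); first by rewrite /= subr_gt0.
move=> w /=; rewrite ltrBrDr -ltrBrDl => zw.
apply: lt_le_trans zw _; rewrite lerBlDr.
by have := ler_normD w (z - w); rewrite addrC subrK.
Qed.

(** The cofactor T collects the roots that are not in the open disc, so it is
    coprime to the stable factor. *)
Lemma derivable_stable_factor (j : nat) (z : C) : 1 < `|z| ->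
  derivable (fun w => (stable_factor w)`_j) z 1.
Proof.
move=> z1.
pose T := lead_coef (P z) *: \prod_(x <- roots_mult (P z) | ~~ (`|x| < 1)) ('X - x%:P).
have factorE w : 1 < `|w| -> P w = stable_factor w *
    (lead_coef (P w) *: \prod_(x <- roots_mult (P w) | ~~ (`|x| < 1)) ('X - x%:P)).
  move=> w1; rewrite -scalerAr /stable_factor kappas_outside // big_filter.
  by rewrite {1}[P w]prod_roots_mult (bigID (fun x => `|x| < 1)).
apply: (@derivable_factor_coef _ stable_factor T 'X^r r) => //.
- apply: filterS (near_outside z1) => w w1; split.
  + exact: monic_prod_XsubC.
  + by rewrite size_prod_XsubC size_kappas // ltW.
  rewrite -factorE //; have -> : P z + (w - z) *: 'X^r = P w.
    by rewrite !scheme_polyE scalerBl addrC addrA subrK.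
  by rewrite [P w]factorE // dvdp_mulIl.
- move=> i A zA; have near_A : nbhs z (fun w => 1 < `|w| -> A (stable_factor w)`_i).
    exact: (@stable_factor_cvg i z (ltW z1) A zA).
  by apply: filterS2 near_A (near_outside z1) => w; apply.
apply/Pdiv.ClosedField.coprimepP => x; rewrite root_prod_XsubC.
rewrite kappas_outside // mem_filter => /andP [x1 _].
rewrite -/(root T x) /T rootZ ?lead_coef_eq0 ?scheme_poly_neq0 //.
by rewrite -big_filter root_prod_XsubC mem_filter x1.
Qed.

Lemma derivable_KL_det (z : C) : 1 < `|z| -> derivable (KL_det r p a b) z 1.
Proof.
move=> z1; apply: (@near_eq_derivable _ _ _ (fun w =>
    reduced_det (boundary_mx r p a b) w (fun j => (stable_factor w)`_j))).
  by apply: filterS (near_outside z1) => w w1; rewrite KL_detE // ltW.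
by apply: derivable_reduced_det => j; exact: derivable_stable_factor.
Qed.

Lemma continuous_KL_det :
  {within [set z : C | 1 <= `|z|], continuous (KL_det r p a b)}.
Proof.
apply/subspace_continuousP => z /= z1.
pose F := within [set z : C | 1 <= `|z|] (nbhs z).
have red : (fun w => reduced_det (boundary_mx r p a b) w
      (fun j => (stable_factor w)`_j)) @ F
    --> reduced_det (boundary_mx r p a b) z (fun j => (stable_factor z)`_j).
  apply: cvg_at_reduced_det => [|j]; first exact: cvg_within.
  apply: (@cvg_within_closure _ outside [set z : C | 1 <= `|z|]
    (fun w => (stable_factor w)`_j)) => //= w w1.
    exact: within_outside_proper.
  exact: stable_factor_cvg.
rewrite /from_subspace KL_detE //; apply: (cvg_trans _ red).
apply: near_eq_cvg; rewrite near_withinE; apply: nearW => w w1 /=.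
by rewrite KL_detE.
Qed.

End Determinant.

Theorem theorem12 (R : realType) (r p m : nat)
    (a : int -> Cplx R) (b : int -> 'I_m -> Cplx R)
    (r_ge1 : (1 <= r)%N) (p_ge1 : (1 <= p)%N) (m_ge : (p + r <= m)%N)
    (a_left : a (- r%:Z) != 0) (a_right : a p%:Z != 0)
    (stable : cauchy_stable r p a) :
  (forall z : Cplx R, 1 < `|z| -> derivable (KL_det r p a b) z 1) /\
  {within [set z : Cplx R | 1 <= `|z|], continuous (KL_det r p a b)}.
Proof.
split; first by move=> z; exact: derivable_KL_det.
exact: continuous_KL_det.
Qed.
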